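(* Let $[C]$ be a set of colours, and associate to each colour $c\in[C]$ an ensemble of random matrices $\{X_c^{(\lambda)}\}_{\lambda\in\Lambda_c}$ satisfying condition (G) with data $(PM_c,f_c)$, independent from the other ensembles. Then these ensembles are asymptotically free.
   Context: **Asymptotic freeness.** Families $\{X_c^{(\lambda)}\}_{\lambda\in\Lambda_c}$ ($c\in[C]$) of $N\times N$ random matrices, given for every $N$, are asymptotically free if for every integer $p>0$, every alternating word $w:[p]\to[C]$ (i.e. $w(1)\neq w(2)\neq\cdots\neq w(p)$), and all $A_i$ in the algebra generated by the $X_{w(i)}^{(\lambda)}$, $\lambda\in\Lambda_{w(i)}$ (that is, $A_i$ is a fixed noncommutative polynomial in these matrices), $1\le i\le p$, $$\lim_{N\to\infty}\mathbb{E}(\mathrm{tr}(\mathring{A}_1\cdots\mathring{A}_p))=0,$$ where $\mathrm{tr}=\frac1N\mathrm{Tr}$ and $\mathring{A}:=A-\mathbb{E}(\mathrm{tr}(A))I_N$. **Permutations.** $[n]=\{1,\ldots,n\}$. For a finite set $I$ of nonzero integers, $-I=\{-k:k\in I\}$, $\pm I=I\cup(-I)$, $S(I)$ is the group of permutations of $I$, products act from right to left, a permutation acts trivially outside its domain, and $\#(\pi)$ is the number of cycles of $\pi$ (on its domain, fixed points included). $\delta:k\mapsto-k$. A premap on $\pm I$ is $\pi\in S(\pm I)$ such that $\pi(k)=-\pi^{-1}(-k)$ for all $k$ and no cycle of $\pi$ contains both $k$ and $-k$; the set of premaps is $PM(\pm I)$. If $I$ does not contain both $k$ and $-k$ for any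 $k$, and $\gamma\in S(I)$, then $\gamma_+\in S(\pm I)$ is $\gamma$ extended by the identity on $-I$, $\gamma_-:=\delta\gamma_+\delta$, and for $\pi\in PM(\pm I)$ $$\chi(\gamma,\pi):=\#(\gamma_+\gamma_-^{-1})/2+\#(\pi)/2+\#(\gamma_+^{-1}\pi^{-1}\gamma_-)/2-|I|$$ (in all three counts the domain is $\pm I$). A cycle is particular if its element of smallest absolute value is positive; for a premap $\pi$, $\pi/2$ is the permutation formed by the particular cycles of $\pi$, on the set of elements of those cycles. Given $\varepsilon:I\to\{1,-1\}$ with $I$ a set of positive integers, put $\varepsilon(-k)=\varepsilon(k)$ and $\delta_\varepsilon:k\mapsto\varepsilon(k)k$. **Trace along a permutation.** For matrices $X_k$ put $X^{(k)}=X_k$ and $X^{(-k)}=X_k^T$. For a permutation $\sigma$ of a finite set of nonzero integers, $\mathrm{tr}_\sigma(\ldots)$ is the product over the cycles $(c_1,\ldots,c_s)$ of $\sigma$ of $\mathrm{tr}(X^{(c_1)}\cdots X^{(c_s)})$. **Condition (G).** A family $\{X_\lambda\}_{\lambda\in\Lambda}$ of $N\times N$ random matrices, given for every $N$ (with $X_\lambda^{(1)}=X_\lambda$, $X_\lambda^{(-1)}=X_\lambda^T$), satisfies (G) with data $(PM_c,f_c)$ if: (i) for each finite set $I$ of positive integers, $PM_c(\pm I)\subseteq PM(\pm I)$ is a subset such that, for every $J\subseteq I$, the $\pi\in PM_c(\pm I)$ which do not connect $\pm J$ and $\pm(I\setminus J)$ (no cycle meets both) are exactly the products $\pi_1\pi_2$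 with $\pi_1\in PM_c(\pm J)$, $\pi_2\in PM_c(\pm(I\setminus J))$; (ii) $f_c$ is a complex-valued function on $\bigcup_I PM_c(\pm I)$ (its value on $\pi\in PM_c(\pm I)$ may depend on $N$ and on the indices $\lambda_k$, $k\in I$) such that $\lim_{N\to\infty}f_c(\pi)$ exists for every $\pi$; (iii) for every finite set $I=\{i_1<\cdots<i_s\}$ of positive integers, $\gamma\in S(I)$, $\varepsilon:I\to\{1,-1\}$, $\lambda_k\in\Lambda$ ($k\in I$), and $N\times N$ random matrices $Y_k$ ($k\in I$) independent from the family $\{X_\lambda\}$ (all expectations existing), $$\mathbb{E}\left(\mathrm{tr}_\gamma(X_{\lambda_{i_1}}^{(\varepsilon(i_1))}Y_{i_1},\ldots,X_{\lambda_{i_s}}^{(\varepsilon(i_s))}Y_{i_s})\right)=\sum_{\pi\in PM_c(\pm I)}N^{\chi(\gamma,\delta_\varepsilon\pi\delta_\varepsilon)-2\#(\gamma)}f_c(\pi)\,\mathbb{E}\left(\mathrm{tr}_{\gamma_-^{-1}\delta_\varepsilon\pi\delta_\varepsilon\gamma_+/2}(Y_{i_1},\ldots,Y_{i_s})\right);$$ (iv) (multiplicativity) if $\pi\in PM_c(\pm I)$ does not connect $\pm J$ and $\pm(I\setminus J)$, then $f_c(\pi)=f_c(\pi|_{\pm J})f_c(\pi|_{\pm(I\setminus J)})$. For $I=\emptyset$, $PM_c$ consists of the empty permutation, with $f_c=1$. *)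

(* Defs.v *)
From HB Require Import structures.
From mathcomp Require Import all_boot all_order all_algebra fingroup perm.
From mathcomp Require Import finmap complex.
From mathcomp Require Import all_classical all_reals all_analysis.

Set Implicit Arguments.
Unset Strict Implicit.
Unset Printing Implicit Defensive.

Import Order.TTheory GRing.Theory Num.Theory numFieldNormedType.Exports.

Local Open Scope ring_scope.

(* A permutation of a finite set D of integers is an element of {perm D}.  To
   compare or combine permutations of different domains, extp extends one by
   the identity to all of int, and restp restricts a map of int to D. *)

Definition extp (D : {fset int}) (s : {perm D}) (k : int) : int :=
  if insub k is Some x then val (s x) else k.

(* The value 1 is junk, used when g does not permute D. *)
Definition restp (D : {fset int}) (g : int -> int) : {perm D} :=
  let h (x : D) : D := insubd x (g (val x)) in
  if @idP (injectiveb h) is ReflectT inj_h then perm (injectiveP h inj_h)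
  else 1%g.

Lemma extpE (D : {fset int}) (s : {perm D}) (x : D) :
  extp s (val x) = val (s x).
Proof. by rewrite /extp valK. Qed.

Lemma restpE (D : {fset int}) (g : int -> int) (x : D) :
  (forall k, k \in D -> g k \in D) -> {in D &, injective g} ->
  val (restp D g x) = g (val x).
Proof.
move=> gD g_inj; rewrite /restp.
set h := fun y : D => _.
have hE y : val (h y) = g (val y) by rewrite /h insubdK //; apply/gD/valP.
case: {-}_ / idP => [inj_h|[]]; first by rewrite permE hE.
apply/injectiveP => y z /(congr1 val); rewrite !hE => /g_inj eq_yz.
by apply/val_inj/eq_yz; apply: valP.
Qed.

Lemma extp_inj (D : {fset int}) (s : {perm D}) : injective (extp s).
Proof.
move=> k l; rewrite /extp; case: insubP => [u _ <-|kD];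
  case: insubP => [v _ <-|lD] //.
- by move/val_inj/perm_inj->.
- by move=> E; rewrite -E (valP (s u)) in lD.
- by move=> E; rewrite E (valP (s v)) in kD.
Qed.

Definition pm (I : {fset int}) : {fset int} :=
  (I `|` [fset - k | k in I])%fset.

Lemma pmN (I : {fset int}) (k : int) : (- k \in pm I) = (k \in pm I).
Proof.
have aux j : j \in pm I -> - j \in pm I.
  rewrite !inE => /orP[jI|/imfsetP[i /= iI ->]]; last by rewrite opprK iI.
  by apply/orP; right; apply/imfsetP; exists j.
by apply/idP/idP => [/aux|/aux]; rewrite ?opprK.
Qed.

Definition delta (I : {fset int}) : {perm (pm I)} := restp (pm I) -%R.

Lemma deltaE (I : {fset int}) (x : pm I) : val (delta I x) = - val x.
Proof.
by rewrite restpE // => [k|j k _ _ /oppr_inj//]; rewrite pmN.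
Qed.

(* eps is only used on I; extending it evenly is done by the `|k|. *)
Definition deltae (I : {fset int}) (eps : int -> int) : {perm (pm I)} :=
  restp (pm I) (fun k => eps `|k| * k).

Definition posset (I : {fset int}) : Prop := forall k, k \in I -> 0 < k.

Lemma deltaeE (I : {fset int}) (eps : int -> int) (x : pm I) :
  posset I -> (forall k, k \in I -> eps k = 1 \/ eps k = -1) ->
  val (deltae I eps x) = eps `|val x| * val x.
Proof.
move=> I_gt0 eps1.
have absI k : k \in pm I -> `|k| \in I.
  by rewrite !inE => /orP[kI|/imfsetP[j /= jI ->]];
     rewrite ?normrN ger0_norm //; apply/ltW/I_gt0.
have absE k : k \in pm I -> `|eps `|k| * k| = `|k|.
  by move=> /absI/eps1[] ->; rewrite normrM ?normrN !normr1 mul1r.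
rewrite restpE // => [k kI|k l kI lI].
  by case: (eps1 _ (absI _ kI)) => ->; rewrite ?mulN1r ?pmN // mul1r.
move=> Ekl; have nE : `|k| = `|l| by rewrite -(absE k) // -(absE l) // Ekl.
move: Ekl; rewrite nE.
by case: (eps1 _ (absI _ lI)) => ->; rewrite ?mulN1r ?mul1r // => /oppr_inj.
Qed.

(* MathComp permutations multiply from left to right, (s * t) x = t (s x):
   every product below is written in the order opposite to that of the usual
   composition of maps. *)

Definition gplus (I : {fset int}) (g : {perm I}) : {perm (pm I)} :=
  restp (pm I) (extp g).

Lemma gplusE (I : {fset int}) (g : {perm I}) (x : pm I) :
  val (gplus g x) = extp g (val x).
Proof.
rewrite restpE // => [k|k l _ _ /extp_inj//].
by rewrite !inE /extp; case: insubP => //= u _ _ _; rewrite (valP (g u)).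
Qed.

Definition gminus (I : {fset int}) (g : {perm I}) : {perm (pm I)} :=
  (delta I * gplus g * delta I)%g.

Definition ncyc (D : {fset int}) (s : {perm D}) : nat := #|porbits s|.

Definition premap (I : {fset int}) : {set {perm (pm I)}} :=
  [set p : {perm (pm I)} | [forall k : pm I,
     (p k == delta I ((p^-1)%g (delta I k))) && (delta I k \notin porbit p k)]].

(* The halves are exact on premaps p: gamma_+ gamma_-^-1 has 2 #(gamma) cycles,
   and in p and gamma_+^-1 p^-1 gamma_-, which is again a premap, the cycles
   come in distinct pairs c, delta c^-1 delta. *)
Definition chi (I : {fset int}) (g : {perm I}) (p : {perm (pm I)}) : int :=
  ((ncyc ((gminus g)^-1 * gplus g)%g)./2 + (ncyc p)./2 +
   (ncyc (gminus g * p^-1 * (gplus g)^-1)%g)./2)%N%:Z - #|` I|%:Z.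

Definition particular (D : {fset int}) (s : {perm D}) (x : D) : bool :=
  [exists y, [&& y \in porbit s x, 0 < val y &
    [forall z, (z \in porbit s x) ==> (`|val y| <= `|val z|)]]].

Definition phalf_dom (D : {fset int}) (s : {perm D}) : {fset int} :=
  [fset val x | x : D & particular s x]%fset.

Definition phalf (D : {fset int}) (s : {perm D}) : {perm (phalf_dom s)} :=
  restp (phalf_dom s) (extp s).

Lemma in_phalf_dom (D : {fset int}) (s : {perm D}) (x : D) :
  (val x \in phalf_dom s) = particular s x.
Proof.
by apply/imfsetP/idP => /= [[y yp /val_inj->]//|px]; exists x.
Qed.

Lemma phalfE (D : {fset int}) (s : {perm D}) (x : phalf_dom s) :
  val (phalf s x) = extp s (val x).
Proof.
rewrite restpE // => [k ks|k l _ _ /extp_inj//].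
have kD : k \in D by case/imfsetP: ks => y _ ->; apply: valP.
move: ks; rewrite -[k]/(val (Sub k kD : D)) extpE !in_phalf_dom.
case/existsP => y yP; apply/existsP; exists y.
by rewrite (porbit_perm s 1).
Qed.

Definition disconnects (I J : {fset int}) (p : {perm (pm I)}) : Prop :=
  forall x y : pm I, val x \in pm J -> val y \in pm (I `\` J)%fset ->
    y \notin porbit p x.

Section Traces.
Variables (F : fieldType) (N : nat).
Implicit Types M : 'M[F]_N.

Definition ntr M : F := \tr M / N%:R.

(* sgnmx k X is X for k > 0 and X^T for k < 0: it gives both X^(eps(k)) and,
   applied to X_`|k|, X^(k). *)
Definition sgnmx (k : int) M : 'M[F]_N := if 0 < k then M else M^T.

(* Each cycle is read from its canonical representative; by cyclicity of the
   trace the choice is immaterial. *)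
Definition trp (D : {fset int}) (s : {perm D}) (X : int -> 'M[F]_N) : F :=
  \prod_(x in froots s) ntr (\prod_(y <- orbit s x) sgnmx (val y) (X `|val y|)).

(* A noncommutative polynomial in indeterminates labelled by L, as a formal
   linear combination of words. *)
Definition ncpoly (L : Type) : Type := seq (F * seq L).

Definition nceval (L : Type) (a : ncpoly L) (X : L -> 'M[F]_N) : 'M[F]_N :=
  \sum_(m <- a) m.1 *: \prod_(l <- m.2) X l.

End Traces.

Section Probability.
Context {d : measure_display} {T : measurableType d} {R : realType}.
Variable P : probability T R.

Definition cintegrable (g : T -> R[i]) : Prop :=
  P.-integrable setT (fun t => (complex.Re (g t))%:E) /\
  P.-integrable setT (fun t => (complex.Im (g t))%:E).

Definition cexp (g : T -> R[i]) : R[i] :=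
  Complex (\int[P]_t complex.Re (g t)) (\int[P]_t complex.Im (g t)).

(* The entries are random variables (the measurability is part of
   integrability) all of whose joint moments exist. *)
Definition has_moments (N : nat) (L : Type) (X : L -> T -> 'M[R[i]]_N) : Prop :=
  forall s : seq (L * 'I_N * 'I_N),
    cintegrable (fun t => \prod_(e <- s) X e.1.1 t e.1.2 e.2).

Definition sigma_rmx (N : nat) (L : Type) (X : L -> T -> 'M[R[i]]_N) :
    set (set T) :=
  <<s [set A | exists l i j (B : set R), measurable B /\
        (A = (fun t => complex.Re (X l t i j)) @^-1` B \/
         A = (fun t => complex.Im (X l t i j)) @^-1` B)] >>%classic.

Definition indep_rmx (N : nat) (L K : Type) (X : L -> T -> 'M[R[i]]_N)
    (Y : K -> T -> 'M[R[i]]_N) : Prop :=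
  forall A B, sigma_rmx X A -> sigma_rmx Y B ->
    P (A `&` B)%classic = (P A * P B)%E.

Definition mutually_indep_rmx (N C : nat) (L : 'I_C -> Type)
    (X : forall c, L c -> T -> 'M[R[i]]_N) : Prop :=
  forall A : 'I_C -> set T, (forall c, sigma_rmx (X c) (A c)) ->
    P (\bigcap_c A c)%classic = (\prod_(c < C) P (A c))%E.

End Probability.

Section ConditionG.
Variables (d : measure_display) (R : realType).
Variables (T : nat -> measurableType d) (P : forall N, probability (T N) R).
Variables (L : Type) (X : forall N, L -> T N -> 'M[R[i]]_N).
Variable PM : forall I : {fset int}, {set {perm (pm I)}}.
(* f N I lam p is f_c(p) at size N for the indices lam k, k in I. *)
Variable f : nat -> forall I : {fset int}, (int -> L) -> {perm (pm I)} -> R[i].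

Definition condG_premaps : Prop :=
  forall I, posset I -> PM I \subset premap I /\
    forall (J : {fset int}) (p : {perm (pm I)}), (J `<=` I)%fset ->
      (p \in PM I /\ disconnects J p) <->
      exists p1 p2, [/\ p1 \in PM J, p2 \in PM (I `\` J)%fset &
                        extp p =1 extp p1 \o extp p2].

(* The first conjunct says that f_c(p) only depends on the lam k, k in I. *)
Definition condG_limits : Prop :=
  forall I (lam : int -> L) (p : {perm (pm I)}), posset I -> p \in PM I ->
    (forall N (lam' : int -> L), (0 < N)%N -> {in I, lam =1 lam'} ->
       f N lam p = f N lam' p) /\
    (exists l : R[i]^o, (fun N => f N lam p : R[i]^o) @ \oo --> l)%classic.

Definition condG_expansion : Prop :=
  forall (N : nat) (I : {fset int}) (g : {perm I}) (eps : int -> int)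
      (lam : int -> L) (Y : int -> T N -> 'M[R[i]]_N),
    (0 < N)%N -> posset I ->
    (forall k, k \in I -> eps k = 1 \/ eps k = -1) ->
    has_moments (P N) (fun k : I => Y (val k)) ->
    indep_rmx (P N) (@X N) (fun k : I => Y (val k)) ->
    cexp (P N) (fun t =>
        trp g (fun k => sgnmx (eps k) (X (lam k) t) *m Y k t)) =
    \sum_(p in PM I)
      let q := (deltae I eps * p * deltae I eps)%g in
      N%:R ^ (chi g q - (2 * ncyc g)%N%:Z) * f N lam p *
      cexp (P N) (fun t =>
        trp (phalf (gplus g * q * (gminus g)^-1)%g) (fun k => Y k t)).

Definition condG_multiplicative : Prop :=
  forall (N : nat) (I J : {fset int}) (lam : int -> L) (p : {perm (pm I)}),
    (0 < N)%N -> posset I -> (J `<=` I)%fset ->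
    p \in PM I -> disconnects J p ->
    f N lam p = f N lam (restp (pm J) (extp p)) *
                f N lam (restp (pm (I `\` J)%fset) (extp p)).

(* The moments of X exist as a consequence of the expansion formula when it is
   read, for deterministic Y, as asserting the existence of its left-hand side;
   since cexp is total this must be said explicitly. *)
Record condG : Prop := CondG {
  condG_moments : forall N, (0 < N)%N -> has_moments (P N) (@X N);
  condG_i : condG_premaps;
  condG_ii : condG_limits;
  condG_iii : condG_expansion;
  condG_iv : condG_multiplicative;
  condG_empty : PM fset0 = [set 1%g] /\
    forall N lam, (0 < N)%N -> f N lam (1%g : {perm (pm fset0)}) = 1 }.

End ConditionG.

Section Freeness.
Variables (d : measure_display) (R : realType).
Variables (T : nat -> measurableType d) (P : forall N, probability (T N) R).

Definition centered (N : nat) (A : T N -> 'M[R[i]]_N) (t : T N) : 'M[R[i]]_N :=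
  A t - (cexp (P N) (fun u => ntr (A u)))%:M.

Definition asymptotically_free (C : nat) (L : 'I_C -> Type)
    (X : forall c N, L c -> T N -> 'M[R[i]]_N) : Prop :=
  forall (p : nat) (w : 'I_p -> 'I_C) (a : forall i, ncpoly R[i] (L (w i))),
    (0 < p)%N ->
    (forall i j : 'I_p, j = i.+1 :> nat -> w i != w j) ->
    ((fun N => cexp (P N) (fun t => ntr (\prod_(i < p)
        centered (fun u => nceval (a i) (fun l => X (w i) N l u)) t)) : R[i]^o)
      @ \oo --> (0 : R[i]^o))%classic.

End Freeness.

(* Main.v *)
Require Import Defs.
From mathcomp Require Import all_boot all_order all_algebra fingroup perm.
From mathcomp Require Import finmap complex.
From mathcomp Require Import all_classical all_reals all_analysis.
From mathcomp Require Import measurable_realfun zify ring.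

Set Implicit Arguments.
Unset Strict Implicit.
Unset Printing Implicit Defensive.

Import Order.TTheory GRing.Theory Num.Theory numFieldNormedType.Exports.
Local Open Scope ring_scope.

(** A premap pi of I u (-I) is the same thing as a pairing of its points: the
    map x |-> - pi(x) is an involution without fixed points.  Reading the
    expansion formula of condition (G) for gamma = 1, eps = 1 and the constant
    matrices Y_k = N E_(phi(-k), phi(k)) shows that the joint moments of the
    entries are sums over such pairings,

      E prod_(k in I) X_k(phi(k), phi(-k)) =
        sum_(pi in PM(I)) N^(#(pi)/2 - |I|) f(pi) [phi(- pi x) = phi(x) for all x],

    which is [entry_product_expansion].  In this form nothing is left of gamma,
    and several independent ensembles are treated at once, by multiplying the
    formulas of the different colours.

    Centering.  Since f, the power of N and the indicator are multiplicative
    when pi does not connect J to the rest of I, subtracting the expectation of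
    the letters of J removes exactly the premaps that leave J isolated
    ([centered_expansion]).  The expectation of a word in one ensemble is a
    scalar matrix, because the formula is invariant under relabelling the
    indices, and because a pairing meets every index an even number of times
    ([pathmx_scalar]); hence centering a word W by E tr(W) amounts to centering
    each of the products of entries that make it up.

    Expanding tr of a product of p centered words over closed paths of indices
    therefore gives

      E tr(...) = sum_pi (prod_c f_c(pi_c)) N^(#(pi)/2 - n - 1) #{paths compatible
        with pi},

    where n is the number of letters and pi runs over the unions of one premap
    per colour for which no word is isolated ([word_limit]).  As every f_c(pi_c)
    converges, it is enough to see that N^(#(pi)/2) #{compatible paths} is at
    most N^n ([count_bound]), so that each term is O(1/N).

    The genus bound.  Place the 2n ends of the letters on a circle.  Besides the
    pairing tau given by pi there are two more pairings: delta joins the two ends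
    of a letter, sigma joins neighbouring ends of consecutive letters.  Let V_A be
    the group of functions from the ends to Z/N which are invariant under the
    pairings in A.  Then N^(#(pi)/2) is at most |V_(delta,tau)|
    ([half_cycles_bound]), and the number of compatible paths is at most
    |V_(sigma,tau)|.  Addition maps V_(delta,tau) x V_(sigma,tau) to V_tau, which
    has N^n elements, with fibres of at most N elements, since delta and sigma
    together act transitively.  If tau is crossing, the sums are annihilated by a
    surjective homomorphism from V_tau to Z/N, built from alternating sums along
    an arc; this gains the missing factor N ([circle_crossing_bound]).  Finally
    tau is crossing: it preserves colours, neighbouring words have different
    colours and no word is isolated, so a pair joining two different words at
    minimal distance encloses a word that is joined to something outside
    ([exists_crossing]). *)

(** * Expectations of products of independent real variables *)

Section Independence.
Context {d : measure_display} {T : measurableType d} {R : realType}.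
Variable P : probability T R.
Local Open Scope classical_set_scope.
Import HBNNSimple.

(** Measurability with respect to the sigma-algebra generated by G, which is
    coarser than that of the ambient space. *)
Definition real_measurable (G : set (set T)) (Z : T -> R) : Prop :=
  @measurable_fun _ _ (g_sigma_algebraType G) R setT Z.

Lemma real_measurable_fun (G : set (set T)) (Z : T -> R) :
  G `<=` d.-measurable -> real_measurable G Z -> measurable_fun setT Z.
Proof.
move=> Gm mZ _ B mB; have := mZ measurableT B mB.
by apply: smallest_sub => //; exact: sigma_algebra_measurable.
Qed.

(** The identity holds for indicators of G-measurable sets by assumption, hence
    for simple G-measurable functions by linearity, hence for Z by monotone
    convergence. *)
Lemma ge0_integral_indep (G : set (set T)) (W Z : T -> R) (K : R) :
  G `<=` d.-measurable ->
  measurable_fun setT W -> (forall t, 0 <= W t) ->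
  (forall A, <<s G >> A -> \int[P]_t (\1_A t * W t)%:E = P A * K%:E)%E ->
  real_measurable G Z -> (forall t, 0 <= Z t) ->
  (\int[P]_t (Z t * W t)%:E = (\int[P]_t (Z t)%:E) * K%:E)%E.
Proof.
move=> Gm mW W0 HA mZ Z0.
pose TG : measurableType _ := g_sigma_algebraType G.
pose ZE (t : TG) : \bar R := (Z t)%:E.
have mZE : measurable_fun (setT : set TG) ZE by exact/measurable_EFinP.
pose g := nnsfun_approx measurableT mZE.
have mg n : measurable_fun setT (g n : T -> R).
  apply: (real_measurable_fun Gm); exact: (@measurable_funPT _ _ TG R (g n)).
have g_cvg (t : T) : EFin \o (fun n => g n t) @ \oo --> (Z t)%:E.
  apply: (cvg_nnsfun_approx measurableT mZE) => // x _.
  by rewrite lee_fin.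
have ndg (t : T) : {homo (fun n => g n t) : n m / (n <= m)%N >-> n <= m}.
  move=> n m nm.
  by have /lefP := nd_nnsfun_approx measurableT mZE nm.
have g0 n t : 0 <= g n t by [].
have mgn n r : <<s G >> (g n @^-1` [set r] : set T).
  have := @measurable_funPT _ _ TG R (g n) measurableT [set r].
  by rewrite setTI; apply; exact: measurable_set1.
have mgnT n r : d.-measurable (g n @^-1` [set r] : set T).
  by have := mgn n r; apply: smallest_sub => //; exact: sigma_algebra_measurable.
have gE n (V : T -> R) : measurable_fun setT V -> (forall t, 0 <= V t) ->
    (\int[P]_t (g n t * V t)%:E =
     \sum_(r \in range (g n)) r%:E *
        \int[P]_t (\1_(g n @^-1` [set r]) t * V t)%:E)%E.
  move=> mV V0.
  have mIV r : measurable_fun setT (fun t : T => \1_(g n @^-1` [set r]) t * V t).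
    by apply: measurable_funM => //; exact: measurable_indic.
  have mul0 r t : 0 <= r * (\1_(g n @^-1` [set r]) t : R).
    rewrite indicE; case: (boolP (t \in _)) => [|_]; last by rewrite mulr0.
    by rewrite inE /= => <-; rewrite mulr1.
  transitivity (\int[P]_t (\sum_(r \in range (g n))
      (r * (\1_(g n @^-1` [set r]) t * V t))%:E))%E.
    apply: eq_integral => t _; rewrite fsumEFin //.
    congr EFin; rewrite {1}(fimfunE (g n)) mulrC fsbig_distrr //=.
    by apply: eq_fsbigr => r _; rewrite mulrC mulrA.
  rewrite ge0_integral_fsum //.
  - apply: eq_fsbigr => r; rewrite inE => -[x _ <-].
    under eq_integral do rewrite EFinM.
    by rewrite ge0_integralZl_EFin //;
      [move=> t _; rewrite lee_fin mulr_ge0|exact/measurable_EFinP].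
  - move=> r; apply/measurable_EFinP; apply: measurable_funM => //.
  - by move=> r t _; rewrite lee_fin mulrA mulr_ge0.
have EgW n : (\int[P]_t (g n t * W t)%:E = (\int[P]_t (g n t)%:E) * K%:E)%E.
  have := gE n (cst 1) (measurable_cst _) (fun=> ler01).
  under eq_integral do rewrite mulr1.
  move=> ->; rewrite gE // ge0_mule_fsuml; last first.
    move=> r; under eq_integral do rewrite mulr1.
    rewrite integral_indic ?setIT //; have [r0|r0] := leP 0 r.
      by rewrite mule_ge0 ?lee_fin.
    by rewrite preimage_nnfun0 // measure0 mule0.
  apply: eq_fsbigr => r _; rewrite HA // muleA; congr (_ * _ * _)%E.
  under eq_integral do rewrite mulr1.
  by rewrite integral_indic ?setIT.
have cvg_int (V : T -> R) : measurable_fun setT V -> (forall t, 0 <= V t) ->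
    (\int[P]_t (g n t * V t)%:E @[n --> \oo] --> \int[P]_t (Z t * V t)%:E)%E.
  move=> mV V0.
  have lV t : limn (fun n => (g n t * V t)%:E) = (Z t * V t)%:E.
    apply/cvg_lim => //; under eq_fun do rewrite EFinM.
    by rewrite EFinM; apply: cvgeZr => //; exact: g_cvg.
  under eq_integral do rewrite -lV.
  apply: (@cvg_monotone_convergence _ _ _ P setT measurableT
            (fun n t => (g n t * V t)%:E)).
  - by move=> n; apply/measurable_EFinP; apply: measurable_funM.
  - by move=> n t _; rewrite lee_fin mulr_ge0.
  - by move=> t _ n m nm; rewrite lee_fin ler_wpM2r // ndg.
have := cvg_int W mW W0.
under eq_fun do rewrite EgW.
have := cvg_int (cst 1) (measurable_cst _) (fun=> ler01).
under eq_fun do under eq_integral do rewrite mulr1.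
under eq_integral do rewrite mulr1.
move=> /(cvgeZr (erefl : K%:E \is a fin_num)) c1 c2.
by rewrite -(cvg_lim _ c2) //; apply/cvg_lim.
Qed.

Section Product.
Variables (C : nat) (G : 'I_C -> set (set T)).
Hypothesis Gm : forall c, G c `<=` d.-measurable.
Hypothesis Gind : forall A : 'I_C -> set T, (forall c, <<s G c >> (A c)) ->
  P (\bigcap_c A c) = (\prod_(c < C) P (A c))%E.

(** The product formula for indicators is the independence hypothesis; the
    indicators are replaced by the functions Z c one colour at a time. *)
Lemma ge0_integral_prod (Z : 'I_C -> T -> R) :
  (forall c, real_measurable (G c) (Z c)) -> (forall c t, 0 <= Z c t) ->
  (forall c, P.-integrable setT (EFin \o Z c)) ->
  (\int[P]_t (\prod_c Z c t)%:E = (\prod_c \int[P]_t Z c t)%:E)%E.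
Proof.
move=> mZ Z0 iZ.
(* The first k factors are general, the others are indicators. *)
pose V k (A : 'I_C -> set T) (c : 'I_C) t := if (c < k)%N then Z c t else \1_(A c) t.
have GmT c A : <<s G c >> A -> d.-measurable A.
  by apply: smallest_sub; [exact: sigma_algebra_measurable|exact: Gm].
suff key k (A : 'I_C -> set T) : (k <= C)%N -> (forall c, <<s G c >> (A c)) ->
    (\int[P]_t (\prod_c V k A c t)%:E =
     (\prod_(c < C) (if (c < k)%N then \int[P]_t Z c t else fine (P (A c))))%:E)%E.
  have := key C (fun=> setT) (leqnn _) (fun c => @measurableT _
      (g_sigma_algebraType (G c))).
  rewrite (eq_bigr (fun c => \int[P]_t Z c t)) => [<-|c _]; last by rewrite ltn_ord.
  apply: eq_integral => t _; congr EFin.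
  by apply: eq_bigr => c _; rewrite /V ltn_ord.
elim: k A => [|k IHk] A kC GA.
  (* The product of the indicators is the indicator of the intersection. *)
  have -> : (\prod_(c < C) (if (c < 0)%N then \int[P]_t Z c t
      else fine (P (A c))))%:E = (\prod_(c < C) P (A c))%E.
    rewrite -prodEFin; apply: eq_bigr => c _ /=; rewrite fineK //.
    exact: fin_num_measure (GmT _ _ (GA c)).
  rewrite -Gind // -[X in P X]setIT -integral_indic //; last first.
    by apply: fin_bigcap_measurable => // c _; apply: GmT (GA c).
  apply: eq_integral => t _; congr EFin; rewrite indicE.
  case: (boolP (t \in _)) => [|/negP tA].
    rewrite inE => tA; rewrite big1 // => c _; rewrite /V ltn0 indicE mem_set //.
    exact: tA.
  have [c cA] : exists c, ~ A c t.
    by apply/existsNP => tA'; apply: tA; rewrite inE => c _.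
  by rewrite (bigD1 c) //= /V ltn0 indicE memNset // mul0r.
pose c0 := Ordinal kC.
have Vne A' c t : c != c0 -> V k A' c t = V k.+1 A' c t.
  move=> ne; rewrite /V ltnS (leq_eqVlt c); suff /negbTE-> : (c : nat) != k by [].
  by apply: contraNneq ne => E; apply/eqP/val_inj.
have mV k' c : measurable_fun setT (V k' A c).
  rewrite /V; case: ltnP => _; last exact/measurable_indic/(GmT _ _ (GA c)).
  exact: real_measurable_fun (mZ c).
have V0 k' c t : 0 <= V k' A c t by rewrite /V; case: ltnP.
under eq_integral do rewrite (bigD1 c0) //=.
rewrite {1}/V ltnSn /=.
rewrite (bigD1 c0) //= ltnSn EFinM.
have -> : ((\int[P]_t Z c0 t)%R%:E = \int[P]_t (Z c0 t)%:E)%E.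
  by rewrite /Rintegral fineK //; exact: integrable_fin_num (iZ c0).
pose W t := \prod_(i < C | i != c0) V k.+1 A i t.
apply: (ge0_integral_indep (G := G c0) (W := W)) => //.
- rewrite /W; under eq_fun do rewrite -big_filter.
  by apply: measurable_prod => c _; exact: mV.
- by move=> t; apply: prodr_ge0 => c _.
move=> B GB; pose A' c := if c == c0 then B else A c.
have GA' c : <<s G c >> (A' c) by rewrite /A'; case: eqVneq => [->|].
have := IHk A' (ltnW kC) GA'.
have A'c0 : A' c0 = B by rewrite /A' eqxx.
rewrite (bigD1 c0) //= ltnn A'c0 EFinM fineK; last first.
  exact: fin_num_measure (GmT _ _ GB).
have -> : \prod_(i < C | i != c0) (if (i < k)%N then (\int[P]_t Z i t)%R else
    fine (P (A' i)))
 = \prod_(i < C | i != c0) (if (i < k.+1)%N then (\int[P]_t Z i t)%R else fine (P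
     (A i))).
  apply: eq_bigr => c ne; rewrite /A' (negbTE ne) ltnS (leq_eqVlt c).
  suff /negbTE-> : (c : nat) != k by [].
  by apply: contraNneq ne => E; apply/eqP/val_inj.
move=> <-; apply: eq_integral => t _; congr EFin.
rewrite [RHS](bigD1 c0) //= {1}/V ltnn A'c0; congr (_ * _).
apply: eq_bigr => c ne; rewrite -Vne // /V /A' (negbTE ne).
by case: ltnP.
Qed.

End Product.
End Independence.

(** * Complex expectations *)

Section ComplexExpectation.
Context {d : measure_display} {T : measurableType d} {R : realType}.
Variable P : probability T R.
Implicit Types (g h : T -> R[i]) (a z : R[i]).
Local Notation cint := (cintegrable P).
Local Notation E := (cexp P).

Lemma complex_eta z : z = Complex (complex.Re z) (complex.Im z).
Proof. by case: z. Qed.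

Lemma ReD z a : complex.Re (z + a) = complex.Re z + complex.Re a.
Proof. by case: z a => ? ? []. Qed.
Lemma ImD z a : complex.Im (z + a) = complex.Im z + complex.Im a.
Proof. by case: z a => ? ? []. Qed.
Lemma ReM z a : complex.Re (z * a) =
  complex.Re z * complex.Re a - complex.Im z * complex.Im a.
Proof. by case: z a => ? ? []. Qed.
Lemma ImM z a : complex.Im (z * a) =
  complex.Re z * complex.Im a + complex.Im z * complex.Re a.
Proof. by case: z a => ? ? []. Qed.

Lemma integrable_cst (r : R) : P.-integrable setT (EFin \o (fun _ : T => r)).
Proof. exact: finite_measure_integrable_cst. Qed.

Lemma integrable_lin2 (r s : R) (u v : T -> R) :
  P.-integrable setT (EFin \o u) -> P.-integrable setT (EFin \o v) ->
  P.-integrable setT (EFin \o (fun t => r * u t + s * v t)).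
Proof.
move=> iu iv; apply: (eq_integrable measurableT
  ((fun t => r%:E * (u t)%:E) \+ (fun t => s%:E * (v t)%:E))%E) => //.
exact: (integrableD measurableT (integrableZl measurableT r iu) (integrableZl
    measurableT s iv)).
Qed.

Lemma Rintegral_lin2 (r s : R) (u v : T -> R) :
  P.-integrable setT (EFin \o u) -> P.-integrable setT (EFin \o v) ->
  \int[P]_t (r * u t + s * v t) = r * \int[P]_t u t + s * \int[P]_t v t.
Proof.
move=> iu iv; have iZ (a : R) w : P.-integrable setT (EFin \o w) ->
    P.-integrable setT (EFin \o (fun t => a * w t)).
  by move=> iw; exact: (integrableZl measurableT a iw).
by rewrite RintegralD ?RintegralZl //; apply: iZ.
Qed.

Lemma cint_cst a : cint (fun=> a).
Proof. by split; exact: integrable_cst. Qed.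

Lemma cexp_cst a : E (fun=> a) = a.
Proof.
have P1 : fine (P setT) = 1 by rewrite probability_setT.
rewrite /cexp !Rintegral_cst // P1 !mulr1.
by rewrite -complex_eta.
Qed.

Lemma cintD g h : cint g -> cint h -> cint (fun t => g t + h t).
Proof.
move=> [g1 g2] [h1 h2]; split.
  have := integrable_lin2 1 1 g1 h1; apply: eq_integrable => // t _ /=.
  by rewrite ReD !mul1r.
have := integrable_lin2 1 1 g2 h2; apply: eq_integrable => // t _ /=.
by rewrite ImD !mul1r.
Qed.

Lemma cexpD g h : cint g -> cint h -> E (fun t => g t + h t) = E g + E h.
Proof.
move=> [g1 g2] [h1 h2]; rewrite /cexp.
under eq_Rintegral do rewrite ReD.
under [X in Complex _ X]eq_Rintegral do rewrite ImD.
by rewrite !RintegralD.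
Qed.

Lemma cintZ a g : cint g -> cint (fun t => a * g t).
Proof.
move=> [g1 g2]; split.
  have := integrable_lin2 (complex.Re a) (- complex.Im a) g1 g2.
  by apply: eq_integrable => // t _ /=; rewrite ReM mulNr.
have := integrable_lin2 (complex.Re a) (complex.Im a) g2 g1.
by apply: eq_integrable => // t _ /=; rewrite ImM.
Qed.

Lemma cexpZ a g : cint g -> E (fun t => a * g t) = a * E g.
Proof.
move=> [g1 g2]; rewrite /cexp.
under eq_Rintegral do rewrite ReM -mulNr.
under [X in Complex _ X]eq_Rintegral do rewrite ImM.
rewrite !Rintegral_lin2 // mulNr.
by rewrite [RHS]complex_eta ReM ImM.
Qed.

Lemma cint_sum (I : Type) (s : seq I) (Q : pred I) (g : I -> T -> R[i]) :
  (forall i, Q i -> cint (g i)) -> cint (fun t => \sum_(i <- s | Q i) g i t).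
Proof.
move=> ig; elim: s => [|i s IHs].
  by under eq_fun do rewrite big_nil; exact: cint_cst.
under eq_fun do rewrite big_cons.
by case: (boolP (Q i)) => Qi //; apply: cintD => //; exact: ig.
Qed.

Lemma cexp_sum (I : Type) (s : seq I) (Q : pred I) (g : I -> T -> R[i]) :
  (forall i, Q i -> cint (g i)) ->
  E (fun t => \sum_(i <- s | Q i) g i t) = \sum_(i <- s | Q i) E (g i).
Proof.
move=> ig; elim: s => [|i s IHs].
  by under eq_fun do rewrite big_nil; rewrite big_nil cexp_cst.
under eq_fun do rewrite big_cons.
rewrite big_cons; case: (boolP (Q i)) => Qi //.
by rewrite cexpD ?IHs //; [exact: ig|exact: cint_sum].
Qed.

Lemma eq_cexp g h : g =1 h -> E g = E h.
Proof. by move=> /funext ->. Qed.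

Lemma cint_real (u : T -> R) : P.-integrable setT (EFin \o u) ->
  cint (fun t => (u t)%:C%C).
Proof. by move=> iu; split => //=; exact: integrable_cst. Qed.

Lemma cexp_real (u : T -> R) : P.-integrable setT (EFin \o u) ->
  E (fun t => (u t)%:C%C) = (\int[P]_t u t)%:C%C.
Proof.
by move=> iu; rewrite /cexp /= Rintegral_cst // mul0r.
Qed.

(** A complex function is a combination, with the coefficients 1, -1, i, -i of
    [cpart_coef], of the positive and negative parts of its real and imaginary
    parts; this reduces multilinear identities to nonnegative functions. *)
Definition cpart (g : T -> R[i]) (j : 'I_4) : T -> R :=
  match val j with
  | 0 => funrpos (fun t => complex.Re (g t))
  | 1 => funrneg (fun t => complex.Re (g t))
  | 2 => funrpos (fun t => complex.Im (g t))
  | _ => funrneg (fun t => complex.Im (g t))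
  end.

Definition cpart_coef (j : 'I_4) : R[i] :=
  match val j with 0 => 1 | 1 => -1 | 2 => 'i%C | _ => - 'i%C end.

Lemma cpartE g t : g t = \sum_j cpart_coef j * (cpart g j t)%:C%C.
Proof.
rewrite !big_ord_recl big_ord0 /= /cpart_coef /cpart /=.
have fE (u : T -> R) : u t = (funrpos u t) - (funrneg u t).
  by rewrite -[in LHS](funrposBneg u).
rewrite {1}[g t]complexE {1}(fE (fun t => complex.Re (g t))).
rewrite {1}(fE (fun t => complex.Im (g t))).
rewrite !rmorphB /= mulrBr mul1r !mulN1r addr0 mulNr addrA.
by rewrite !addrA.
Qed.

Lemma cpart_ge0 g j t : 0 <= cpart g j t.
Proof.
by case: j => -[|[|[|]]] //= i; rewrite /cpart /= ?funrpos_ge0 ?funrneg_ge0.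
Qed.

Lemma cpart_integrable g j : cint g -> P.-integrable setT (EFin \o cpart g j).
Proof.
move=> [ig1 ig2]; case: j => -[|[|[|j]]] i; rewrite /cpart /=.
- by have := integrable_funrpos measurableT ig1.
- by have := integrable_funrneg measurableT ig1.
- by have := integrable_funrpos measurableT ig2.
- by have := integrable_funrneg measurableT ig2.
Qed.

Definition complex_measurable (G : set (set T)) (g : T -> R[i]) : Prop :=
  real_measurable G (fun t => complex.Re (g t)) /\ real_measurable G (fun t =>
      complex.Im (g t)).

Lemma cpart_measurable G g j : complex_measurable G g -> real_measurable G (cpart g j).
Proof.
move=> [ig1 ig2]; rewrite /real_measurable.
case: j => -[|[|[|j]]] i; rewrite /cpart /=.
- by apply: measurable_funrpos.
- by apply: measurable_funrneg.
- by apply: measurable_funrpos.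
- by apply: measurable_funrneg.
Qed.

Lemma complex_measurable_cst G a : complex_measurable G (fun=> a).
Proof. by split; apply: measurable_cst. Qed.

Lemma complex_measurableD G g h : complex_measurable G g -> complex_measurable G
    h -> complex_measurable G (fun t => g t + h t).
Proof.
move=> [g1 g2] [h1 h2]; split; rewrite /real_measurable.
  by under eq_fun do rewrite ReD; apply: measurable_funD.
by under eq_fun do rewrite ImD; apply: measurable_funD.
Qed.

Lemma complex_measurableM G g h : complex_measurable G g -> complex_measurable G
    h -> complex_measurable G (fun t => g t * h t).
Proof.
move=> [g1 g2] [h1 h2]; split; rewrite /real_measurable.
  under eq_fun do rewrite ReM.
  by apply: measurable_funB; apply: measurable_funM.
under eq_fun do rewrite ImM.
by apply: measurable_funD; apply: measurable_funM.
Qed.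

Section Product.
Local Open Scope classical_set_scope.
Variables (C : nat) (G : 'I_C -> set (set T)).
Hypothesis Gm : forall c, G c `<=` d.-measurable.
Hypothesis Gind : forall A : 'I_C -> set T, (forall c, <<s G c >> (A c)) ->
  P (\bigcap_c A c) = (\prod_(c < C) P (A c))%E.

(** Both sides are multilinear, so it suffices to treat the nonnegative parts of
    the factors.  Integrability of the product comes from the nonnegative case
    as well, since all the integrals there are finite. *)
Lemma cexp_prod (Z : 'I_C -> T -> R[i]) :
  (forall c, complex_measurable (G c) (Z c)) -> (forall c, cint (Z c)) ->
  cint (fun t => \prod_c Z c t) /\
  E (fun t => \prod_c Z c t) = \prod_c E (Z c).
Proof.
move=> mZ iZ.
pose part (J : {ffun 'I_C -> 'I_4}) t := \prod_c cpart (Z c) (J c) t.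
have ipart J : (\int[P]_t (part J t)%:E =
    (\prod_c \int[P]_t cpart (Z c) (J c) t)%:E)%E.
  apply: (ge0_integral_prod Gm Gind).
  - by move=> c; exact: cpart_measurable.
  - by move=> c t; exact: cpart_ge0.
  - by move=> c; exact: cpart_integrable.
have part0 J t : 0 <= part J t by apply: prodr_ge0 => c _; exact: cpart_ge0.
have partI J : P.-integrable setT (EFin \o part J).
  apply/integrableP; split.
    apply/measurable_EFinP; apply: measurable_prod => c _.
    by have := real_measurable_fun (@Gm c) (cpart_measurable (J c) (mZ c)).
  under eq_integral do rewrite /= ger0_norm //.
  by rewrite ipart ltry.
have -> : (fun t => \prod_c Z c t) = (fun t => \sum_(J : {ffun 'I_C -> 'I_4})
    (\prod_c cpart_coef (J c)) * (part J t)%:C%C).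
  apply/funext => t; under eq_bigr do rewrite cpartE.
  rewrite bigA_distr_bigA /=; apply: eq_bigr => J _.
  by rewrite big_split /= -rmorph_prod.
split; first by apply: cint_sum => J _; apply: cintZ; apply: cint_real (partI J).
rewrite cexp_sum; last by move=> J _; apply: cintZ; apply: cint_real (partI J).
under [RHS]eq_bigr => c _.
  rewrite (eq_cexp (cpartE (Z c))) cexp_sum; last first.
    by move=> j _; apply: cintZ; apply: cint_real; exact: cpart_integrable.
  under eq_bigr => j _.
    rewrite cexpZ; last by apply: cint_real; exact: cpart_integrable.
    rewrite cexp_real; last exact: cpart_integrable.
    over.
  over.
rewrite bigA_distr_bigA /=; apply: eq_bigr => J _.
rewrite big_split /= -rmorph_prod cexpZ; last by apply: cint_real (partI J).
congr (_ * _); rewrite (cexp_real (partI J)).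
by congr _%:C%C; rewrite /Rintegral ipart.
Qed.

End Product.
End ComplexExpectation.

(** * Polynomials in the entries of random matrices *)

Section PolynomialVariables.
Local Open Scope classical_set_scope.
Context {d : measure_display} {T : measurableType d} {R : realType}.
Variable P : probability T R.
Variables (N : nat) (L : Type) (X : L -> T -> 'M[R[i]]_N).
Implicit Types (Z W : T -> R[i]).

(** The generators of [sigma_rmx X]. *)
Definition rmx_gen : set (set T) :=
  [set A | exists l i j (B : set R), measurable B /\
     (A = (fun t => complex.Re (X l t i j)) @^-1` B \/
      A = (fun t => complex.Im (X l t i j)) @^-1` B)]%classic.

Lemma complex_measurable_entry l i j : complex_measurable rmx_gen (fun t => X l t i j).
Proof.
by split => _ B mB; rewrite setTI; apply: sub_sigma_algebra;
  exists l, i, j, B; split; [|left| |right].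
Qed.

(** Polynomial random variables are closed under sums and products, and, when all
    joint moments of the entries exist, integrable. *)
Definition rmx_poly Z : Prop :=
  exists q : seq (R[i] * seq (L * 'I_N * 'I_N)),
    Z =1 fun t => \sum_(m <- q) m.1 * \prod_(e <- m.2) X e.1.1 t e.1.2 e.2.

Lemma rmx_poly_cst a : rmx_poly (fun=> a).
Proof. by exists [:: (a, [::])] => t; rewrite big_seq1 big_nil mulr1. Qed.

Lemma rmx_poly_entry l i j : rmx_poly (fun t => X l t i j).
Proof.
by exists [:: (1, [:: (l, i, j)])] => t; rewrite big_seq1 big_seq1 mul1r.
Qed.

Lemma rmx_polyD Z W : rmx_poly Z -> rmx_poly W -> rmx_poly (fun t => Z t + W t).
Proof.
by move=> [q Zq] [r Wr]; exists (q ++ r) => t; rewrite big_cat Zq Wr.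
Qed.

Lemma rmx_polyM Z W : rmx_poly Z -> rmx_poly W -> rmx_poly (fun t => Z t * W t).
Proof.
move=> [q Zq] [r Wr].
exists [seq (m.1 * m'.1, m.2 ++ m'.2) | m <- q, m' <- r] => t.
rewrite big_allpairs_dep Zq Wr mulr_suml; apply: eq_bigr => m _.
rewrite mulr_sumr; apply: eq_bigr => m' _ /=.
by rewrite big_cat mulrACA.
Qed.

Lemma rmx_poly_sum (I : Type) (s : seq I) (Q : pred I) (Z : I -> T -> R[i]) :
  (forall i, rmx_poly (Z i)) -> rmx_poly (fun t => \sum_(i <- s | Q i) Z i t).
Proof.
move=> pZ; elim: s => [|i s IHs].
  by under eq_fun do rewrite big_nil; exact: rmx_poly_cst.
under eq_fun do rewrite big_cons.
by case: (Q i) => //; apply: rmx_polyD.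
Qed.

Lemma rmx_poly_prod (I : Type) (s : seq I) (Q : pred I) (Z : I -> T -> R[i]) :
  (forall i, Q i -> rmx_poly (Z i)) -> rmx_poly (fun t => \prod_(i <- s | Q i) Z i t).
Proof.
move=> pZ; elim: s => [|i s IHs].
  by under eq_fun do rewrite big_nil; exact: rmx_poly_cst.
under eq_fun do rewrite big_cons.
by case: (boolP (Q i)) => // Qi; apply: rmx_polyM => //; exact: pZ.
Qed.

Lemma rmx_poly_measurable Z : rmx_poly Z -> complex_measurable rmx_gen Z.
Proof.
move=> [q /funext ->]; elim: q => [|m q IHq].
  by under eq_fun do rewrite big_nil; exact: complex_measurable_cst.
under eq_fun do rewrite big_cons; apply: complex_measurableD => //.
apply: complex_measurableM; first exact: complex_measurable_cst.
elim: (m.2) => [|e s IHs].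
  by under eq_fun do rewrite big_nil; exact: complex_measurable_cst.
under eq_fun do rewrite big_cons.
by apply: complex_measurableM => //; exact: complex_measurable_entry.
Qed.

Hypothesis momX : has_moments P X.

Lemma rmx_poly_cint Z : rmx_poly Z -> cintegrable P Z.
Proof. by move=> [q /funext ->]; apply: cint_sum => m _; apply: cintZ. Qed.

Lemma rmx_gen_measurable : (rmx_gen `<=` d.-measurable)%classic.
Proof.
move=> A [l [i [j [B [mB AE]]]]].
have [ire iim] := rmx_poly_cint (rmx_poly_entry l i j).
have /measurable_EFinP mre := measurable_int _ ire.
have /measurable_EFinP mim := measurable_int _ iim.
by case: AE => ->; rewrite -[X in measurable X]setTI; [apply: mre|apply: mim].
Qed.

(** Constant matrices generate the trivial sigma-algebra. *)
Lemma indep_rmx_cst (K : Type) (Y : K -> 'M[R[i]]_N) :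
  indep_rmx P X (fun k _ => Y k).
Proof.
move=> A B XA YB.
have mA : d.-measurable A.
  by apply: smallest_sub XA => //;
     [exact: sigma_algebra_measurable|exact: rmx_gen_measurable].
suff [->|->] : B = set0 \/ B = setT.
- by rewrite setI0 measure0 mule0.
- by rewrite setIT probability_setT mule1.
(* The sets that are empty or full form a sigma-algebra. *)
suff sub : sigma_rmx (fun k (_ : T) => Y k) `<=` [set D | D = set0 \/ D = setT].
  exact: sub YB.
apply: smallest_sub.
  split => [|D|F FT]; first by left.
  - by move=> [->|->]; rewrite ?setD0 ?setDT; [right|left].
  - have [[n Fn]|nF] := pselect (exists n, F n = setT).
      right; apply/seteqP; split => // t _; exists n => //; by rewrite Fn.
    left; apply/seteqP; split => // t [n _ Fnt].
    by case: (FT n) => Fn; [rewrite Fn in Fnt|case: nF; exists n].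
move=> D [k [i [j [D' [_ [->|->]]]]]].
- have [H|H] := pselect (D' (complex.Re (Y k i j))); [right|left];
    by apply/seteqP; split.
- have [H|H] := pselect (D' (complex.Im (Y k i j))); [right|left];
    by apply/seteqP; split.
Qed.

Lemma has_moments_cst (K : Type) (Y : K -> 'M[R[i]]_N) :
  has_moments P (fun k (_ : T) => Y k).
Proof. by move=> s; exact: cint_cst. Qed.

End PolynomialVariables.

(** * Cycles of permutations of finite sets of integers *)

Section FsetPerm.
Implicit Types (D E I J : {fset int}) (k : int).

Lemma extp_out D (s : {perm D}) k : k \notin D -> extp s k = k.
Proof. by move=> kD; rewrite /extp insubN. Qed.

Lemma extp_in D (s : {perm D}) k : (extp s k \in D) = (k \in D).
Proof.
rewrite /extp; case: insubP => [x kD _|/negbTE //].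
by rewrite kD (valP (s x)).
Qed.

Lemma extp_val D (s : {perm D}) k (kD : k \in D) :
  extp s k = val (s (Sub k kD : D)).
Proof. by rewrite -extpE SubK. Qed.

Lemma extp_eq D (s s' : {perm D}) : {in D, extp s =1 extp s'} -> s = s'.
Proof.
by move=> ss; apply/permP => x; apply: val_inj; rewrite -!extpE; apply/ss/valP.
Qed.

Lemma extp1 D k : extp (1 : {perm D})%g k = k.
Proof. by rewrite /extp; case: insubP => //= x _ <-; rewrite perm1. Qed.

Lemma extp_restp D (g : int -> int) k :
  (forall l, l \in D -> g l \in D) -> {in D &, injective g} ->
  extp (restp D g) k = if k \in D then g k else k.
Proof.
move=> gD g_inj; case: (boolP (k \in D)) => kD; last exact: extp_out.
by rewrite extp_val restpE.
Qed.

Lemma extp_iter D (s : {perm D}) n (x : D) :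
  val (iter n s x) = iter n (extp s) (val x).
Proof. by elim: n => //= n <-; rewrite extpE. Qed.

Lemma mem_porbit_iter D (s : {perm D}) (x y : D) :
  reflect (exists n, val y = iter n (extp s) (val x)) (y \in porbit s x).
Proof.
apply: (iffP (porbitP _ _ _)) => -[n E]; exists n.
  by rewrite E permX extp_iter.
by apply: val_inj; rewrite E permX extp_iter.
Qed.

(** The length of a cycle is the least period of the iterates of any of its
    points, so it only depends on how the permutation moves integers; this
    compares cycles of permutations of different sets. *)
Lemma card_porbit_le D E (s : {perm D}) (s' : {perm E}) (x : D) (x' : E) :
  val x = val x' ->
  (forall n, iter n (extp s) (val x) = iter n (extp s') (val x')) ->
  (#|porbit s' x'| <= #|porbit s x|)%N.
Proof.
move=> xx' ss; rewrite leqNgt; apply/negP => lt_nm.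
set n := #|_| in lt_nm; have letter_count_gt0 : (0 < n)%N by rewrite lt0n
    card_porbit_neq0.
have := uniq_traject_porbit s' x'.
move/(uniqP x')/(_ 0%N n).
rewrite !inE size_traject lt_nm lt0n card_porbit_neq0 => /(_ isT isT).
rewrite !nth_traject //; last by rewrite lt0n card_porbit_neq0.
move=> H; suff E0 : 0%N = n by rewrite -E0 in letter_count_gt0.
by apply: H; apply: val_inj; rewrite [RHS]extp_iter -ss -extp_iter /n iter_porbit.
Qed.

(** Summed over all points this gives the number of cycles.  Cycle counts of
    permutations with different domains thereby become sums over integers, which
    can be split and compared termwise. *)
Definition inv_cycle_length D (s : {perm D}) k : rat :=
  if (insub k : option D) is Some x then (#|porbit s x|%:R)^-1 else 0.

Lemma inv_cycle_lengthE D (s : {perm D}) (x : D) : inv_cycle_length s (val x) =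
    (#|porbit s x|%:R)^-1.
Proof. by rewrite /inv_cycle_length valK. Qed.

Lemma ncyc_sum D (s : {perm D}) : (ncyc s)%:R = \sum_(k <- D) inv_cycle_length s k.
Proof.
rewrite big_seq_fsetE /=; under eq_bigr do rewrite inv_cycle_lengthE.
rewrite (partition_big_imset (porbit s)) /=.
rewrite /ncyc /porbits -sum1_card natr_sum; apply: eq_bigr => O /imsetP[x _ ->].
rewrite (eq_bigr (fun=> (#|porbit s x|%:R)^-1)) => [|y /eqP -> //].
rewrite sumr_const; transitivity ((#|porbit s x|%:R)^-1 *+ #|porbit s x| : rat).
  by rewrite -[RHS]mulr_natr mulVf // pnatr_eq0 card_porbit_neq0.
by congr (_ *+ _); apply: eq_card => y; rewrite -eq_porbit_mem.
Qed.

Lemma eq_inv_cycle_length D E (s : {perm D}) (s' : {perm E}) k : k \in D -> k \in E ->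
  (forall n, iter n (extp s) k = iter n (extp s') k) -> inv_cycle_length s k =
      inv_cycle_length s' k.
Proof.
move=> kD kE ss; pose x : D := Sub k kD; pose x' : E := Sub k kE.
rewrite -[k in LHS]/(val x) -[k in RHS]/(val x') !inv_cycle_lengthE; congr (_%:R^-1).
by apply/eqP; rewrite eqn_leq !card_porbit_le.
Qed.

End FsetPerm.

(** * Premaps and their particular cycles *)

Section Premap.
Variable I : {fset int}.
Hypothesis I_gt0 : posset I.
Variable p : {perm (pm I)}.
Hypothesis pI : p \in premap I.
Implicit Types (x y : pm I).
Local Notation dl := (delta I).

Lemma deltaK : involutive dl.
Proof. by move=> x; apply: val_inj; rewrite !deltaE opprK. Qed.

Lemma pm_neq0 x : val x != 0.
Proof.
have := valP x; rewrite !inE => /orP[/I_gt0|/imfsetP[j /= /I_gt0 j0 ->]].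
  by rewrite lt0r => /andP[].
by rewrite oppr_eq0; move: j0; rewrite lt0r => /andP[].
Qed.

(** In other words x |-> - p(x) is an involution. *)
Lemma premap_delta x : p (dl (p x)) = dl x.
Proof.
move: pI; rewrite inE => /forallP/(_ x)/andP[/eqP E _].
by rewrite E deltaK permKV.
Qed.

Lemma delta_notin x : dl x \notin porbit p x.
Proof. by move: pI; rewrite inE => /forallP/(_ x)/andP[]. Qed.

Lemma premap_deltaV x : (p^-1)%g (dl x) = dl (p x).
Proof. by apply: (@perm_inj _ p); rewrite permKV premap_delta. Qed.

Lemma porbit_delta x y : (dl y \in porbit p (dl x)) = (y \in porbit p x).
Proof.
have aux u v : u \in porbit p v -> dl u \in porbit p (dl v).
  case/porbitP => n ->; rewrite -porbitV; apply/porbitP; exists n.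
  rewrite !permX; elim: n => //= n <-.
  by rewrite premap_deltaV.
by apply/idP/idP => [/aux|/aux //]; rewrite !deltaK.
Qed.

Lemma card_porbit_delta x : #|porbit p (dl x)| = #|porbit p x|.
Proof.
rewrite -(card_imset (porbit p x) (inv_inj deltaK)); apply: eq_card => y.
apply/idP/imsetP => [yx|[z zx ->]]; last by rewrite porbit_delta.
by exists (dl y); rewrite ?deltaK // -porbit_delta deltaK.
Qed.

Lemma particular_porbit x y : y \in porbit p x ->
  particular p x = particular p y.
Proof. by rewrite -eq_porbit_mem => /eqP E; rewrite /particular E. Qed.

Lemma particular_perm x : particular p (p x) = particular p x.
Proof. by apply/esym/particular_porbit; rewrite (mem_porbit _ 1). Qed.

(** The points of smallest absolute value in the cycles of x and of -x are
    opposite, and each is unique in its cycle, because a cycle of a premap does not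
    contain both y and -y. *)
Lemma particular_delta x : particular p (dl x) = ~~ particular p x.
Proof.
pose y := [arg min_(y < x | y \in porbit p x) absz (val y)].
have [yx ymin] : y \in porbit p x /\
    forall z, z \in porbit p x -> (absz (val y) <= absz (val z))%N.
  by rewrite /y; case: arg_minnP => //; exact: porbit_id.
have key u : u \in porbit p x -> absz (val u) = absz (val y) -> u = y.
  move=> ux /eqP E.
  have : `|val u| == `|val y| by rewrite -!abszE (eqP E).
  rewrite eqr_norm2 => /orP[/eqP/val_inj //|/eqP uy].
  have ud : u = dl y by apply: val_inj; rewrite deltaE.
  have := delta_notin y; rewrite -ud -eq_porbit_mem; move: ux yx.
  by rewrite -!eq_porbit_mem => /eqP-> /eqP->; rewrite eqxx.
have part u : (forall v, (v \in porbit p u) -> (absz (val y) <= absz (val v))%N) ->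
    forall v, v \in porbit p u -> absz (val v) = absz (val y) ->
    (forall w, w \in porbit p u -> absz (val w) = absz (val y) -> w = v) ->
    particular p u = (0 < val v).
  move=> umin v vu vy uniq_v; apply/existsP/idP.
    move=> [w /and3P[wu w0 /forallP wmin]]; suff E : v = w by rewrite E.
    symmetry; apply: uniq_v => //; apply/eqP; rewrite eqn_leq umin // andbT.
    by rewrite -vy; move/(_ v): wmin; rewrite vu /= -!abszE lez_nat.
  move=> v0; exists v; rewrite vu v0; apply/forallP => z; apply/implyP => zu.
  by rewrite -!abszE lez_nat vy umin.
rewrite (part x ymin y yx erefl key).
have -> : particular p (dl x) = (0 < val (dl y)); first apply: part.
- by move=> v; rewrite -[v]deltaK porbit_delta => /ymin; rewrite !deltaE !abszN.
- by rewrite porbit_delta.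
- by rewrite deltaE abszN.
- move=> w; rewrite -[w]deltaK porbit_delta => wx; rewrite deltaE abszN => /key.
  by move=> -> .
by rewrite deltaE oppr_gt0 -leNgt le_eqVlt (negbTE (pm_neq0 y)).
Qed.

Lemma phalf_perm_in k : k \in phalf_dom p -> k \in pm I.
Proof. by case/imfsetP => x _ ->; exact: valP. Qed.

Lemma extp_phalf k : k \in phalf_dom p -> extp (phalf p) k = extp p k.
Proof. by move=> kd; rewrite extp_val phalfE. Qed.

Lemma sum_particular (V : zmodType) (F : int -> V) :
  \sum_(k <- phalf_dom p) F k = \sum_(x | particular p x) F (val x).
Proof.
rewrite big_imfset /=; last by move=> x y _ _ /val_inj.
by rewrite big_filter big_enum_cond.
Qed.

(** Negation exchanges the particular points with the others. *)
Lemma sum_pm_particular (V : zmodType) (F : int -> V) :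
  (forall x, F (- val x) = F (val x)) ->
  \sum_(k <- pm I) F k = (\sum_(k <- phalf_dom p) F k) *+ 2.
Proof.
move=> Fe; rewrite sum_particular big_seq_fsetE /= (bigID (particular p)) /=.
rewrite mulr2n; congr (_ + _).
rewrite (reindex_inj (inv_inj deltaK)) /=; apply: eq_big => x.
  by rewrite particular_delta negbK.
by rewrite deltaE Fe.
Qed.

Lemma ncyc_phalf : ncyc p = (ncyc (phalf p)).*2.
Proof.
apply/eqP; rewrite -(eqr_nat rat) -muln2 natrM !ncyc_sum mulr_natr.
rewrite sum_pm_particular => [|x]; last first.
  by rewrite -deltaE !inv_cycle_lengthE card_porbit_delta.
apply/eqP; congr (_ *+ 2); rewrite big_seq [RHS]big_seq; apply: eq_bigr => k kd.
apply: eq_inv_cycle_length => // [|n]; first exact: phalf_perm_in.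
have in_dom m : iter m (extp (phalf p)) k \in phalf_dom p.
  by elim: m => //= m; rewrite extp_in.
by elim: n => //= n IHn; rewrite IHn extp_phalf ?in_dom.
Qed.

Lemma card_pm : #|` pm I| = (#|` I|).*2.
Proof.
rewrite /pm cardfsU (_ : (I `&` _)%fset = fset0).
  by rewrite cardfs0 subn0 card_imfset /= ?addnn //; exact: oppr_inj.
apply/fsetP => k; rewrite !inE; apply/negbTE/negP => /andP[/I_gt0 k0].
case/imfsetP => j /= /I_gt0 j0 E; move: k0; rewrite E oppr_gt0.
by rewrite ltNge ltW.
Qed.

Lemma card_phalf_dom : #|` phalf_dom p| = #|` I|.
Proof.
apply: double_inj; rewrite -card_pm; apply/eqP; rewrite -(eqr_nat rat) -muln2 natrM.
have cE (D : {fset int}) : #|` D|%:R = \sum_(k <- D) (1 : rat).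
  by rewrite big_const_seq count_predT iter_addr_0.
by rewrite !cE sum_pm_particular // mulr_natr.
Qed.

End Premap.

(** * Traces along a permutation of elementary matrices *)

Section TraceOfElementaryMatrices.
Variables (F : fieldType) (N : nat) (T : finType) (s : {perm T}).
Variables (al be : T -> 'I_N).
Implicit Types x y : T.

Lemma fconnect_porbit x y : fconnect s x y = (y \in porbit s x).
Proof.
apply/idP/porbitP => [c|[n ->]]; last by rewrite permX fconnect_iter.
by exists (findex s x y); rewrite permX iter_findex.
Qed.

Lemma in_orbit_froots x y : x \in froots s -> (y \in orbit s x) = (froot s y == x).
Proof.
move=> /eqP rx; rewrite -fconnect_orbit -{2}rx.
by rewrite (root_connect (fconnect_sym perm_inj)) (fconnect_sym perm_inj).
Qed.

Lemma prod_froots_orbit (K : comPzSemiRingType) (G : T -> K) :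
  \prod_(x in froots s) \prod_(y <- orbit s x) G y = \prod_y G y.
Proof.
rewrite [RHS](partition_big (froot s) (mem (froots s))) /=; last first.
  by move=> y _; apply: roots_root; exact: (fconnect_sym perm_inj).
apply: eq_bigr => x xr; rewrite big_uniq ?orbit_uniq //=.
by apply: eq_bigl => y; rewrite in_orbit_froots.
Qed.

Lemma card_froots : #|froots s| = #|porbits s|.
Proof.
have <- : porbit s @: (froots s) = porbits s.
  apply/setP => O; apply/imsetP/imsetP => -[x _ ->]; first by exists x.
  exists (froot s x); first by apply: roots_root; exact: (fconnect_sym perm_inj).
  by apply/esym/eqP; rewrite eq_porbit_mem -fconnect_porbit connect_root.
rewrite card_in_imset // => x y /eqP rx /eqP ry /eqP.
rewrite eq_porbit_mem -fconnect_porbit -(root_connect (fconnect_sym perm_inj)).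
by rewrite rx ry => /eqP.
Qed.

(** E_(a,b) E_(a',b') is E_(a,b') or 0 according to whether b = a'. *)
Lemma prod_delta_mx (c : F) x r : fpath s x r ->
  \prod_(y <- x :: r) (c *: delta_mx (al y) (be y) : 'M[F]_N) =
  (c ^+ (size r).+1 * \prod_(y <- belast x r) (be y == al (s y))%:R)
    *: delta_mx (al x) (be (last x r)).
Proof.
elim: r x => [|z r IHr] x /=; first by rewrite big_seq1 big_nil mulr1.
case/andP => /eqP xz zr; rewrite big_cons IHr // big_cons xz.
rewrite -[LHS]/(mulmx _ _) -scalemxAl -scalemxAr scalerA mul_delta_mx_cond.
rewrite -scaler_nat scalerA; congr (_ *: _).
by rewrite [c ^+ (size r).+2]exprS; ring.
Qed.

(** The trace of a product of elementary matrices along a cycle is the indicator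
    that consecutive indices agree; each factor N belongs to a point and each 1/N to
    a cycle. *)
Lemma prod_ntr_delta_mx :
  \prod_(x in froots s) ntr (\prod_(y <- orbit s x)
      (N%:R *: delta_mx (al y) (be y) : 'M[F]_N)) =
  N%:R ^+ #|T| / N%:R ^+ #|porbits s| *
    ([forall y, be y == al (s y)]%:R).
Proof.

have -> : ([forall y, be y == al (s y)]%:R : F) = \prod_y (be y == al (s y))%:R.
  case: forallP => [H|H]; first by rewrite big1 // => y _; rewrite H.
  have [y ny] : exists y, ~~ (be y == al (s y)).
    by apply/existsP; rewrite -negb_forall; apply/forallP.
  by rewrite (bigD1 y) //= (negbTE ny) mul0r.
rewrite -card_froots -(prod_froots_orbit (fun y => (be y == al (s y))%:R)).
have -> : N%:R ^+ #|T| = \prod_(x in froots s) \prod_(y <- orbit s x) (N%:R : F).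
  by rewrite prod_froots_orbit prodr_const cardT.
rewrite -prodr_const -prodf_div -big_split /=; apply: eq_bigr => x _.
have [r ox] : exists r, orbit s x = x :: r.
  by rewrite /orbit; case E: (fingraph.order s x) => [|n]; [move:
      (fingraph.order_gt0 s x); rewrite E|exists (traject s (s x) n)].
have /= := fpath_traject s x (fingraph.order s x).-1.
have -> : traject s (s x) (fingraph.order s x).-1 = r.
  by move: ox; rewrite /orbit -orderSpred => -[].
move=> pr; rewrite ox prod_delta_mx // /ntr mxtraceZ.
have lastx : s (last x r) = x.
  have := cycle_orbit (@perm_inj _ s) x; rewrite ox /= rcons_path => /andP[_ /eqP].
  by [].
have -> : \tr (delta_mx (al x) (be (last x r)) : 'M[F]_N) = (al x == be (last x r))%:R.
  rewrite /mxtrace (bigD1 (al x)) //= big1 => [|i ix]; rewrite mxE ?eqxx ?addr0 //.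
  by rewrite (negbTE ix).
rewrite [in RHS]big_const_seq count_predT iter_mulr_1 /=.
have -> : \prod_(y <- x :: r) (be y == al (s y))%:R =
  (\prod_(y <- belast x r) (be y == al (s y))%:R) * (al x == be (last x r))%:R :> F.
  by rewrite lastI big_rcons /= lastx eq_sym.
by ring.
Qed.

End TraceOfElementaryMatrices.

(** * Joint moments of entries *)

Section EntryMoments.
Variables (d : measure_display) (R : realType).
Variables (T : nat -> measurableType d) (P : forall N, probability (T N) R).
Variables (L : Type) (X : forall N, L -> T N -> 'M[R[i]]_N).
Variable PM : forall I : {fset int}, {set {perm (pm I)}}.
Variable f : nat -> forall I : {fset int}, (int -> L) -> {perm (pm I)} -> R[i].
Hypothesis GX : condG P X PM f.

(** That phi is constant on the pairs {x, - p(x)}. *)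
Definition compatible N (phi : int -> 'I_N) (I : {fset int}) (p : {perm (pm I)}) :=
  [forall x : pm I, phi (- val (p x)) == phi (val x)].

(** The contribution of a premap to the joint moment of the entries
    (phi(k), phi(-k)), k in I. *)
Definition premap_weight N (lam : int -> L) (phi : int -> 'I_N) (I : {fset int})
    (p : {perm (pm I)}) : R[i] :=
  N%:R ^+ (ncyc p)./2 / N%:R ^+ #|` I| * f N lam p * (compatible phi p)%:R.

Definition entry_product N (lam : int -> L) (phi : int -> 'I_N) (I : {fset int})
    (t : T N) : R[i] :=
  \prod_(k <- I) X (lam k) t (phi k) (phi (- k)).

Lemma PM_premap I p : posset I -> p \in PM I -> p \in premap I.
Proof. by move=> /(condG_i GX)[sub _]; exact: (fintype.subsetP sub). Qed.

(** Every pair {x, - p(x)} contains exactly one point of a particular cycle. *)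
Lemma compatible_phalf N (phi : int -> 'I_N) (I : {fset int}) (p : {perm (pm I)}) :
  posset I -> p \in premap I ->
  [forall y : phalf_dom p, phi (val y) == phi (- val (phalf p y))] = compatible phi p.
Proof.
move=> I0 pI; apply/forallP/forallP => H y; last first.
  have yd : val y \in pm I by exact: phalf_perm_in (valP y).
  have := H (Sub (val y) yd); rewrite phalfE extp_val SubK => /eqP ->.
  exact: eqxx.
have Hp z : particular p z -> phi (- val (p z)) = phi (val z).
  move=> zp; have zd : val z \in phalf_dom p by rewrite in_phalf_dom.
  by have /eqP := H (Sub (val z) zd); rewrite phalfE SubK extpE => ->.
have [yp|yp] := boolP (particular p y); first by rewrite Hp.
have := Hp (delta I (p y)); rewrite premap_delta // !deltaE opprK => -> //.
by rewrite particular_delta // particular_perm.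
Qed.

Lemma deltae1 (I : {fset int}) : posset I -> deltae I (fun=> 1) = 1%g.
Proof.
move=> I0; apply/permP => x; apply: val_inj; rewrite perm1 deltaeE //.
  by rewrite mul1r.
by left.
Qed.

Lemma gplus1 (I : {fset int}) : gplus (1 : {perm I})%g = 1%g.
Proof. by apply/permP => x; apply: val_inj; rewrite perm1 gplusE extp1. Qed.

Lemma gminus1 (I : {fset int}) : gminus (1 : {perm I})%g = 1%g.
Proof.
apply/permP => x; rewrite /gminus gplus1 mulg1 permM perm1.
exact: deltaK.
Qed.

Lemma ncyc1 (D : {fset int}) : ncyc (1 : {perm D})%g = #|` D|.
Proof.
have porb1 : injective (porbit (1 : {perm D})%g).
  by move=> x y /eqP; rewrite eq_porbit_mem => /porbitP[n]; rewrite expg1n perm1.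
rewrite /ncyc /porbits card_imset // cardfE.
by apply: eq_card => x.
Qed.

Lemma expfz_cancel (F : fieldType) (x : F) (h n : nat) (z : int) :
  x != 0 -> z = (h + h)%N%:Z - (n + n)%N%:Z ->
  x ^ z * (x ^+ n / x ^+ h) = x ^+ h / x ^+ n.
Proof.
move=> x0 ->; rewrite expfzDr // -exprnN -exprnP !exprD invfM.
have hN : x ^+ h != 0 by rewrite expf_neq0.
have nN : x ^+ n != 0 by rewrite expf_neq0.
by field; rewrite hN nN.
Qed.

Lemma trp_elementary N (phi : int -> 'I_N) (I : {fset int}) (p : {perm (pm I)}) :
  posset I -> p \in premap I ->
  trp (phalf p) (fun k => N%:R *: delta_mx (phi (- k)) (phi k) : 'M[R[i]]_N) =
  N%:R ^+ #|` I| / N%:R ^+ (ncyc p)./2 * (compatible phi p)%:R.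
Proof.
move=> I0 pI; rewrite -compatible_phalf // -(card_phalf_dom I0 pI) cardfE.
rewrite (ncyc_phalf I0 pI) doubleK.
rewrite /ncyc -(prod_ntr_delta_mx R[i] (phalf p) (fun y => phi (- val y))
            (fun y => phi (val y))).
apply: eq_bigr => x _; congr ntr; apply: eq_bigr => y _.
rewrite /sgnmx; case: ltrP => y0; first by rewrite gtr0_norm.
by rewrite ler0_norm // linearZ /= trmx_delta opprK.
Qed.

(** With gamma = 1 and eps = 1 the left-hand side of the expansion formula is the
    expectation of prod_k tr(X_k Y_k), and tr(X_k Y_k) is the entry
    (phi(k), phi(-k)) of X_k when Y_k = N E_(phi(-k), phi(k)).  On the right-hand side
    the exponent is #(p) - 2|I|, and the trace along p/2 contributes
    N^(|I| - #(p)/2) times the indicator of compatibility. *)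
Lemma entry_product_expansion N (lam : int -> L) (phi : int -> 'I_N) (I : {fset int}) :
  (0 < N)%N -> posset I ->
  cexp (P N) (entry_product lam phi I) = \sum_(p in PM I) premap_weight lam phi p.
Proof.
move=> N0 I0.
(* The trace along a permutation transposes Y_k at negative points, so that the
   factor at any point y is N E_(phi(-y), phi(y)). *)
pose Y (k : int) (_ : T N) : 'M[R[i]]_N := N%:R *: delta_mx (phi (- k)) (phi k).
have N0R : (N%:R : R[i]) != 0 by rewrite pnatr_eq0 -lt0n.
have exp : condG_expansion P X PM f := condG_iii GX.
have := exp N I 1%g (fun=> 1) lam Y N0 I0.
move=> /(_ (fun _ _ => or_introl erefl)).
move=> /(_ (@has_moments_cst _ _ _ _ _ _ (fun k : I => Y (val k) point))).
move=> /(_ (@indep_rmx_cst _ _ _ _ _ _ _ (condG_moments GX N0) _ _)).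
rewrite (@eq_cexp _ _ _ _ _ (entry_product lam phi I)); last first.
  move=> t; rewrite /entry_product /trp big_seq_fsetE /=.
  have fr x : froot (1 : {perm I})%g x = x.
    have := connect_root (frel (1%g : {perm I})) x.
    rewrite fconnect_porbit => /porbitP[n ->].
    by rewrite expg1n perm1.
  have o1 x : orbit (1 : {perm I})%g x = [:: x].
    rewrite /orbit /fingraph.order (eq_card (B := pred1 x)) ?card1 // => y.
    rewrite inE fconnect_porbit; apply/porbitP/eqP => [[n ->]|->].
      by rewrite expg1n perm1.
    by exists 0%N; rewrite perm1.
  apply: eq_big => [x|x _]; first by rewrite inE /roots fr eqxx.
  have x0 : 0 < val x by apply/I0/valP.
  rewrite o1 big_seq1 /sgnmx x0 (gtr0_norm x0) ltr01 /Y /ntr.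
  rewrite -scalemxAr mxtraceZ mulrAC divff // mul1r.
  rewrite /mxtrace (bigD1 (phi (val x))) //= big1 => [|i ix].
    rewrite addr0 mxE (bigD1 (phi (- val x))) //= big1 => [|j jx].
      by rewrite mxE !eqxx mulr1 addr0.
    by rewrite mxE (negbTE jx) mulr0.
  by rewrite mxE big1 // => j _; rewrite mxE (negbTE ix) andbF mulr0.
move=> ->; apply: eq_bigr => p pPM.
have pI := PM_premap I0 pPM.
cbv zeta; rewrite deltae1 // gplus1 gminus1 invg1 !(mul1g, mulg1) !ncyc1.
rewrite (@eq_cexp _ _ _ _ _ (fun=> N%:R ^+ #|` I| / N%:R ^+ (ncyc p)./2 *
    (compatible phi p)%:R));
  last by move=> t; exact: trp_elementary.
rewrite cexp_cst /premap_weight mulrA (mulrAC (_ ^ _)) expfz_cancel //.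
rewrite /chi gplus1 gminus1 !invg1 !mulg1 !mul1g /ncyc porbitsV -!/(ncyc _) ncyc1.
rewrite card_pm // doubleK.
set h := (ncyc p)./2; set n := #|` I|; clearbody h n.
by rewrite mul2n -addnn; congr (_ - _); rewrite -addnA PoszD addrAC subrr add0r.
Qed.

End EntryMoments.

(** * Centering removes the premaps that isolate a block *)

Section Centering.
Variables (d : measure_display) (R : realType).
Variables (T : nat -> measurableType d) (P : forall N, probability (T N) R).
Variables (L : Type) (X : forall N, L -> T N -> 'M[R[i]]_N).
Variable PM : forall I : {fset int}, {set {perm (pm I)}}.
Variable f : nat -> forall I : {fset int}, (int -> L) -> {perm (pm I)} -> R[i].
Hypothesis GX : condG P X PM f.
Implicit Types (I J K : {fset int}).

Lemma in_pm I k : posset I -> (k \in pm I) = (`|k| \in I).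
Proof.
move=> I0; rewrite !inE; apply/orP/idP => [[kI|/imfsetP[j /= jI ->]]|kI].
- by rewrite gtr0_norm // I0.
- by rewrite normrN gtr0_norm // I0.
- case: (ltrgt0P k) (I0 _ kI) => [k0|k0|->]; rewrite ?normr0 ?ltxx // => _.
    by left; rewrite -(gtr0_norm k0).
  by right; apply/imfsetP; exists `|k|; rewrite //= ltr0_norm // opprK.
Qed.

Lemma posset_sub I J : (J `<=` I)%fset -> posset I -> posset J.
Proof. by move=> /fsubsetP sJI I0 k /sJI/I0. Qed.

Lemma pm_disjoint I J k : posset I -> (J `<=` I)%fset ->
  k \in pm J -> k \notin pm (I `\` J)%fset.
Proof.
move=> I0 JI; have J0 := posset_sub JI I0; have D0 := posset_sub (fsubsetDl I J) I0.
by rewrite !in_pm // => kJ; rewrite inE kJ.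
Qed.

Lemma pmD I J k : posset I -> (J `<=` I)%fset ->
  (k \in pm I) = (k \in pm J) || (k \in pm (I `\` J)%fset).
Proof.
move=> I0 JI; have J0 := posset_sub JI I0; have D0 := posset_sub (fsubsetDl I J) I0.
rewrite !in_pm // inE; case: (boolP (_ \in J)) => //= kJ.
by rewrite (fsubsetP JI).
Qed.

(** A form of [disconnects] that depends only on the action of p on integers. *)
Definition isolated J I (p : {perm (pm I)}) : bool :=
  all (fun k => extp p k \in pm J) (pm J).

Lemma disconnectsP I J (p : {perm (pm I)}) : posset I -> (J `<=` I)%fset ->
  disconnects J p <-> isolated J p.
Proof.
move=> I0 JI; split=> [dis|/allP iso].
  apply/allP => k kJ; have kI : k \in pm I by rewrite (pmD k I0 JI) kJ.
  have := extp_in p k; rewrite kI (pmD _ I0 JI) => /orP[//|pkD].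
  have := dis (Sub k kI) (p (Sub k kI)); rewrite SubK -extpE SubK.
  by move=> /(_ kJ pkD); rewrite (mem_porbit _ 1).
move=> x y xJ yD; apply/negP => /mem_porbit_iter[n yx].
suff : val y \in pm J by move/(pm_disjoint I0 JI); rewrite yD.
by rewrite yx; elim: n {yx} => //= n /iso.
Qed.

(** The permutation with the cycles of p1 and of p2, for disjoint J and K. *)
Definition glue J K I (p1 : {perm (pm J)}) (p2 : {perm (pm K)}) :
  {perm (pm I)} := restp (pm I) (extp p1 \o extp p2).

Lemma extp_glue I J (p1 : {perm (pm J)}) (p2 : {perm (pm (I `\` J)%fset)}) :
  posset I -> (J `<=` I)%fset ->
  extp (glue I p1 p2) =1 extp p1 \o extp p2.
Proof.
move=> I0 JI k; rewrite extp_restp.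
- case: ifPn => //; rewrite (pmD k I0 JI) negb_or => /andP[kJ kD] /=.
  by rewrite (extp_out _ kD) (extp_out _ kJ).
- move=> l; rewrite !(pmD _ I0 JI) /= => /orP[lJ|lD].
    by rewrite (extp_out _ (pm_disjoint I0 JI lJ)) extp_in lJ.
  have pD : extp p2 l \in pm (I `\` J)%fset by rewrite extp_in.
  by rewrite (extp_out p1) ?pD ?orbT //; apply: contraL pD; exact: pm_disjoint.
- by move=> k1 k2 _ _ /= /extp_inj/extp_inj.
Qed.

Lemma extp_glue_l I J (p1 : {perm (pm J)}) (p2 : {perm (pm (I `\` J)%fset)}) k :
  posset I -> (J `<=` I)%fset -> k \in pm J -> extp (glue I p1 p2) k = extp p1 k.
Proof.
by move=> I0 JI kJ; rewrite extp_glue //= (extp_out _ (pm_disjoint I0 JI kJ)).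
Qed.

Lemma extp_glue_r I J (p1 : {perm (pm J)}) (p2 : {perm (pm (I `\` J)%fset)}) k :
  posset I -> (J `<=` I)%fset -> k \in pm (I `\` J)%fset ->
  extp (glue I p1 p2) k = extp p2 k.
Proof.
move=> I0 JI kD; have pD : extp p2 k \in pm (I `\` J)%fset by rewrite extp_in.
rewrite extp_glue //= (extp_out p1) //.
by apply: contraL pD; exact: pm_disjoint.
Qed.

Definition restrict J I (p : {perm (pm I)}) : {perm (pm J)} :=
  restp (pm J) (extp p).

Lemma restrict_eq J I (p : {perm (pm I)}) (q : {perm (pm J)}) :
  {in pm J, extp p =1 extp q} -> restrict J p = q.
Proof.
move=> pq; apply: extp_eq => k kJ; rewrite extp_restp ?kJ ?pq //.
  by move=> l lJ; rewrite pq // extp_in.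
by move=> ? ? _ _; exact: extp_inj.
Qed.

Lemma glueK_l I J (p1 : {perm (pm J)}) (p2 : {perm (pm (I `\` J)%fset)}) :
  posset I -> (J `<=` I)%fset -> restrict J (glue I p1 p2) = p1.
Proof. by move=> I0 JI; apply: restrict_eq => k kJ; rewrite extp_glue_l. Qed.

Lemma glueK_r I J (p1 : {perm (pm J)}) (p2 : {perm (pm (I `\` J)%fset)}) :
  posset I -> (J `<=` I)%fset -> restrict (I `\` J)%fset (glue I p1 p2) = p2.
Proof. by move=> I0 JI; apply: restrict_eq => k kJ; rewrite extp_glue_r. Qed.

(** One half of the bijection given by condition (i); the other half is
    [PM_glue]. *)
Lemma glue_PM I J (p1 : {perm (pm J)}) (p2 : {perm (pm (I `\` J)%fset)}) :
  posset I -> (J `<=` I)%fset -> p1 \in PM J -> p2 \in PM (I `\` J)%fset ->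
  (glue I p1 p2 \in PM I) && isolated J (glue I p1 p2).
Proof.
move=> I0 JI p1P p2P; have [_ /(_ J (glue I p1 p2) JI) iff] := condG_i GX I0.
case: iff => _ [|gP /(disconnectsP _ I0 JI) ->]; last by rewrite gP.
by exists p1, p2; split => //; exact: extp_glue.
Qed.

Lemma PM_glue I J (p : {perm (pm I)}) :
  posset I -> (J `<=` I)%fset -> p \in PM I -> isolated J p ->
  [/\ restrict J p \in PM J, restrict (I `\` J)%fset p \in PM (I `\` J)%fset &
      glue I (restrict J p) (restrict (I `\` J)%fset p) = p].
Proof.
move=> I0 JI pP iso; have [_ /(_ J p JI) [iff _]] := condG_i GX I0.
have [|p1 [p2 [p1P p2P pE]]] := iff; first by split=> //; apply/disconnectsP.
have {pE iff} -> : p = glue I p1 p2.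
  by apply: extp_eq => k _; rewrite pE extp_glue.
by rewrite glueK_l // glueK_r.
Qed.

Lemma sum_isolated I J (V : zmodType) (Q : pred {perm (pm I)})
    (F : {perm (pm I)} -> V) : posset I -> (J `<=` I)%fset ->
  \sum_(p in PM I | isolated J p && Q p) F p =
  \sum_(p1 in PM J) \sum_(p2 in PM (I `\` J)%fset | Q (glue I p1 p2))
     F (glue I p1 p2).
Proof.
move=> I0 JI; rewrite pair_big_dep /=.
rewrite (reindex_onto (fun pp : {perm (pm J)} * {perm (pm (I `\` J)%fset)} =>
    glue I pp.1 pp.2) (fun p => (restrict J p, restrict (I `\` J)%fset p))) /=.
  apply: eq_bigl => -[p1 p2] /=; rewrite glueK_l // glueK_r // eqxx andbT.
  apply/andP/andP => [[gP /andP[iso Qg]]|[p1P /andP[p2P Qg]]].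
    by have [] := PM_glue I0 JI gP iso; rewrite glueK_l // glueK_r // Qg => -> ->.
  by have /andP[-> ->] := glue_PM I0 JI p1P p2P.
by move=> p /andP[pP /andP[iso _]]; have [] := PM_glue I0 JI pP iso.
Qed.

Lemma isolated_glue I J K (p1 : {perm (pm J)}) (p2 : {perm (pm (I `\` J)%fset)}) :
  posset I -> (J `<=` I)%fset -> (K `<=` I `\` J)%fset ->
  isolated K (glue I p1 p2) = isolated K p2.
Proof.
move=> I0 JI KD; apply: eq_in_all => k kK; rewrite extp_glue_r //.
have D0 := posset_sub (fsubsetDl I J) I0.
rewrite in_pm //; apply: (fsubsetP KD); rewrite -in_pm //.
exact: posset_sub KD D0.
Qed.

Lemma iter_glue_l I J (p1 : {perm (pm J)}) (p2 : {perm (pm (I `\` J)%fset)}) k n :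
  posset I -> (J `<=` I)%fset -> k \in pm J ->
  iter n (extp (glue I p1 p2)) k = iter n (extp p1) k.
Proof.
move=> I0 JI kJ; elim: n => //= n ->; rewrite extp_glue_l //.
by elim: n => //= n; rewrite extp_in.
Qed.

Lemma iter_glue_r I J (p1 : {perm (pm J)}) (p2 : {perm (pm (I `\` J)%fset)}) k n :
  posset I -> (J `<=` I)%fset -> k \in pm (I `\` J)%fset ->
  iter n (extp (glue I p1 p2)) k = iter n (extp p2) k.
Proof.
move=> I0 JI kJ; elim: n => //= n ->; rewrite extp_glue_r //.
by elim: n => //= n; rewrite extp_in.
Qed.

Lemma big_pmD I J (V : zmodType) (F : int -> V) : posset I -> (J `<=` I)%fset ->
  \sum_(k <- pm I) F k =
  \sum_(k <- pm J) F k + \sum_(k <- pm (I `\` J)%fset) F k.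
Proof.
move=> I0 JI; rewrite -big_cat; apply: perm_big; apply: uniq_perm.
- exact: fset_uniq.
- rewrite cat_uniq !fset_uniq andbT /=; apply/hasPn => k kD.
  by apply: contraL kD; exact: pm_disjoint.
- by move=> k; rewrite mem_cat (pmD k I0 JI).
Qed.

Lemma ncyc_glue I J (p1 : {perm (pm J)}) (p2 : {perm (pm (I `\` J)%fset)}) :
  posset I -> (J `<=` I)%fset -> ncyc (glue I p1 p2) = (ncyc p1 + ncyc p2)%N.
Proof.
move=> I0 JI; apply/eqP; rewrite -(eqr_nat rat) natrD !ncyc_sum (big_pmD _ I0 JI).
apply/eqP; congr (_ + _); rewrite big_seq [RHS]big_seq; apply: eq_bigr => k kd;
  apply: eq_inv_cycle_length => // [|n]; rewrite ?(pmD k I0 JI) ?kd ?orbT //.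
  exact: iter_glue_l.
exact: iter_glue_r.
Qed.

Lemma compatibleE N (phi : int -> 'I_N) I (p : {perm (pm I)}) :
  compatible phi p = all (fun k => phi (- extp p k) == phi k) (pm I).
Proof.
apply/forallP/allP => [H k kI|H x].
  by have := H (Sub k kI); rewrite -extpE SubK.
by rewrite -extpE; apply/H/valP.
Qed.

Lemma mulr_interchange4 (F : comNzRingType) (a1 a2 b1 b2 c1 c2 e1 e2 : F) :
  a1 * a2 * (b1 * b2) * (c1 * c2) * (e1 * e2) =
  a1 * b1 * c1 * e1 * (a2 * b2 * c2 * e2).
Proof. by ring. Qed.

(** The number of cycles and of letters add up, f is multiplicative, and
    compatibility can be checked on each part. *)
Lemma premap_weight_glue N lam (phi : int -> 'I_N) I J (p1 : {perm (pm J)})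
    (p2 : {perm (pm (I `\` J)%fset)}) :
  (0 < N)%N -> posset I -> (J `<=` I)%fset ->
  p1 \in PM J -> p2 \in PM (I `\` J)%fset ->
  premap_weight f lam phi (glue I p1 p2) = premap_weight f lam phi p1 *
      premap_weight f lam phi p2.
Proof.
move=> N0 I0 JI p1P p2P; have /andP[gP iso] := glue_PM I0 JI p1P p2P.
have J0 := posset_sub JI I0; have D0 := posset_sub (fsubsetDl I J) I0.
rewrite /premap_weight (condG_iv GX lam N0 I0 JI gP); last exact/disconnectsP.
rewrite -!/(restrict _ _) glueK_l // glueK_r // ncyc_glue //.
have -> : ((ncyc p1 + ncyc p2)./2 = (ncyc p1)./2 + (ncyc p2)./2)%N.
  rewrite (ncyc_phalf J0 (PM_premap GX J0 p1P)) (ncyc_phalf D0 (PM_premap GX D0 p2P)).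
  by rewrite -doubleD !doubleK.
have -> : #|` I| = (#|` J| + #|` (I `\` J)%fset|)%N.
  by rewrite -{1}(cardfsID J) (fsetIidPr JI).
have -> : compatible phi (glue I p1 p2) = compatible phi p1 && compatible phi p2.
  rewrite !compatibleE; apply/allP/andP => [H|[/allP H1 /allP H2] k].
    split; apply/allP => k kd.
      by rewrite -(extp_glue_l p1 p2 I0 JI kd) H // (pmD k I0 JI) kd.
    by rewrite -(extp_glue_r p1 p2 I0 JI kd) H // (pmD k I0 JI) kd orbT.
  rewrite (pmD k I0 JI) => /orP[kd|kd].
    by rewrite extp_glue_l // H1.
  by rewrite extp_glue_r // H2.
by rewrite -mulnb natrM !exprD invfM; exact: mulr_interchange4.
Qed.

Section Expansion.
Variables (N : nat) (lam : int -> L) (phi : int -> 'I_N).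
Hypothesis N0 : (0 < N)%N.
Local Notation W J := (entry_product X lam phi J).
Local Notation E := (cexp (P N)).

Lemma rmx_poly_entry_product J : rmx_poly (X (N := N)) (W J).
Proof. by apply: rmx_poly_prod => k _; exact: rmx_poly_entry. Qed.

Lemma entry_productD I J t : (J `<=` I)%fset -> W I t = W J t * W (I `\` J)%fset t.
Proof.
move=> JI; rewrite /entry_product -big_cat; apply: perm_big; apply: uniq_perm.
- exact: fset_uniq.
- rewrite cat_uniq !fset_uniq andbT /=; apply/hasPn => k.
  by rewrite inE => /andP[].
- move=> k; rewrite mem_cat inE; case: (boolP (k \in J)) => //= kJ.
  by rewrite (fsubsetP JI).
Qed.

Definition outside (Js : seq {fset int}) I : {fset int} :=
  [fset k in I | ~~ has (fun J : {fset int} => k \in J) Js]%fset.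

Lemma in_outside Js I k : (k \in outside Js I) =
  (k \in I) && ~~ has (fun J : {fset int} => k \in J) Js.
Proof. by rewrite !inE. Qed.

(** Induction on the blocks.  Opening the factor W J - E (W J) gives the expansion
    over I minus the product of the expansions over J and over I minus J; by
    multiplicativity the latter is the sum over the premaps of I that isolate J. *)
Lemma centered_expansion (Js : seq {fset int}) I :
  posset I -> all (fun J => J `<=` I)%fset Js ->
  pairwise (fun J K => [disjoint J & K]%fset) Js ->
  E (fun t => W (outside Js I) t * \prod_(J <- Js) (W J t - E (W J))) =
  \sum_(p in PM I | all (fun J => ~~ isolated J p) Js) premap_weight f lam phi p.
Proof.
elim: Js I => [|J Js IHJs] I I0.
  move=> _ _; under eq_bigl do rewrite andbT.
  rewrite -(entry_product_expansion GX lam phi N0 I0).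
  apply: eq_cexp => t; rewrite big_nil mulr1; congr (W _ t).
  by apply/fsetP => k; rewrite in_outside andbT.
move=> /= /andP[JI JsI] /andP[/allP dJ disj].
have D0 := posset_sub (fsubsetDl I J) I0.
have JsD : all (fun K => K `<=` I `\` J)%fset Js.
  apply/allP => K KJs; apply/fsubsetP => k kK.
  rewrite inE (fsubsetP (allP JsI _ KJs)) // andbT.
  by apply: contraL kK => kJ; exact: (fdisjointP (dJ _ KJs)).
have Jout : (J `<=` outside Js I)%fset.
  apply/fsubsetP => k kJ; rewrite in_outside (fsubsetP JI) //=.
  by apply/hasPn => K /dJ/fdisjointP; apply.
have outD : (outside Js I `\` J)%fset = outside (J :: Js) I.
  by apply/fsetP => k; rewrite inE !in_outside /= negb_or; case: (k \in J);
      rewrite ?andbF.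
have outD' : outside Js (I `\` J)%fset = outside (J :: Js) I.
  by apply/fsetP => k; rewrite in_outside inE !in_outside /= negb_or; case: (k
      \in J); rewrite ?andbF.
pose Z t := \prod_(K <- Js) (W K t - E (W K)).
have pZ : rmx_poly (X (N := N)) Z.
  apply: rmx_poly_prod => K _; apply: rmx_polyD; first exact: rmx_poly_entry_product.
  exact: rmx_poly_cst.
have iW K : cintegrable (P N) (fun t => W K t * Z t).
  by apply: (rmx_poly_cint (condG_moments GX N0)); apply: rmx_polyM => //; exact:
      rmx_poly_entry_product.
have -> : E (fun t => W (outside (J :: Js) I) t *
      \prod_(K <- J :: Js) (W K t - E (W K))) =
    E (fun t => W (outside Js I) t * Z t) -
    E (W J) * E (fun t => W (outside Js (I `\` J)%fset) t * Z t).
  rewrite -mulNr -cexpZ // -cexpD //; last exact: cintZ.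
  apply: eq_cexp => t; rewrite big_cons (entry_productD t Jout) outD outD' -/(Z t).
  by ring.
rewrite IHJs // IHJs //.
rewrite [X in X - _](bigID (fun p => isolated J p)) /=.
under [X in X + _ - _]eq_bigl => p do rewrite -andbA (andbC (all _ _)).
rewrite sum_isolated // (entry_product_expansion GX lam phi N0 (posset_sub JI
    I0)) mulr_suml.
rewrite addrAC [X in X - _](_ : _ = \sum_(p1 in PM J) premap_weight f lam phi p1 *
   \sum_(p in PM (I `\` J)%fset | all (fun K => ~~ isolated K p) Js)
       premap_weight f lam phi p).
  rewrite subrr add0r; apply: eq_bigl => p.
  by rewrite -andbA (andbC (all _ _)).
apply: eq_bigr => p1 p1P; rewrite mulr_sumr; apply: eq_big => p2.
  congr (_ && _); apply: eq_in_all => K /(allP JsD) KD.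
  by rewrite isolated_glue.
by move=> /andP[p2P _]; rewrite premap_weight_glue.
Qed.

End Expansion.

End Centering.

(** * Matrix products as sums over paths *)

Section PathSums.
Variables (F : comNzRingType) (N : nat).
Local Notation V := 'I_N.
Implicit Types (theta : (nat -> V) -> F).

Lemma big_tuple0 (G : seq V -> F) : \sum_(s : 0.-tuple V) G s = G [::].
Proof.
rewrite (bigD1 [tuple]) //= big1 ?addr0 // => s /eqP[].
exact: tuple0.
Qed.

Lemma big_tupleS m (G : seq V -> F) :
  \sum_(s : m.+1.-tuple V) G s = \sum_v \sum_(s : m.-tuple V) G (v :: s).
Proof.
rewrite pair_big /= (reindex (fun vs : V * m.-tuple V => [tuple of vs.1 :: vs.2])) //=.
exists (fun s : m.+1.-tuple V => (thead s, [tuple of behead s])) => [[v s] _|s _] /=.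
  by congr (_, _); apply: val_inj.
by rewrite [RHS]tuple_eta.
Qed.

Lemma big_tuple_cat m1 m2 (G : seq V -> F) :
  \sum_(s : (m1 + m2).-tuple V) G s =
  \sum_(s1 : m1.-tuple V) \sum_(s2 : m2.-tuple V) G (s1 ++ s2).
Proof.
elim: m1 G => [|m1 IHm] G.
  by rewrite (big_tuple0 (fun s1 => \sum_(s2 : m2.-tuple V) G (s1 ++ s2))).
rewrite -[LHS]/(\sum_(s : (m1 + m2).+1.-tuple V) G s) big_tupleS.
rewrite (big_tupleS _ (fun s1 => \sum_(s2 : m2.-tuple V) G (s1 ++ s2))).
by apply: eq_bigr => v _; rewrite (IHm (fun s => G (v :: s))).
Qed.

(** Weights of paths with m steps, that is, with the vertices v 0, ..., v m. *)
Definition local_to m theta : Prop :=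
  forall v v' : nat -> V, (forall k, (k <= m)%N -> v k = v' k) -> theta v = theta v'.

(** Here s lists the vertices after a, so that [nth a (a :: s)] is a path from a and
    the entry (a, b) is the total weight of the paths from a to b. *)
Definition pathmx m theta : 'M[F]_N :=
  \matrix_(a, b) \sum_(s : m.-tuple V)
     theta (nth a (a :: s)) * (nth a (a :: s) m == b)%:R.

Lemma nth_path_cat (a : V) (s1 s2 : seq V) k :
  (k <= size s1)%N -> nth a (a :: s1 ++ s2) k = nth a (a :: s1) k.
Proof. by case: k => //= k ks; rewrite nth_cat ks. Qed.

Lemma nth_path_catr (a : V) (s1 s2 : seq V) k : (k <= size s2)%N ->
  nth a (a :: s1 ++ s2) (size s1 + k) =
  nth (nth a (a :: s1) (size s1)) (nth a (a :: s1) (size s1) :: s2) k.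
Proof.
case: k => [_|k ks]; first by rewrite addn0 nth_path_cat.
rewrite addnS /= nth_cat ltnNge leq_addr /= addKn.
exact: set_nth_default.
Qed.

(** A path with m1 + m2 steps is a path with m1 steps followed by a path with m2
    steps that starts at its end. *)
Lemma pathmxM m1 m2 theta1 theta2 : local_to m1 theta1 -> local_to m2 theta2 ->
  pathmx m1 theta1 *m pathmx m2 theta2 =
  pathmx (m1 + m2) (fun v => theta1 v * theta2 (fun k => v (m1 + k)%N)).
Proof.
move=> loc1 loc2; apply/matrixP => a b; rewrite !mxE.
rewrite (big_tuple_cat _ _ (fun s => theta1 (nth a (a :: s)) *
  theta2 (fun k => nth a (a :: s) (m1 + k)%N) * (nth a (a :: s) (m1 + m2) == b)%:R)).
under eq_bigr => c _ do rewrite !mxE mulr_suml.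
rewrite exchange_big /=; apply: eq_bigr => s1 _.
rewrite (bigD1 (nth a (a :: s1) m1)) //= [X in _ + X]big1 ?addr0; last first.
  by move=> c nc; rewrite eq_sym (negbTE nc) mulr0 mul0r.
rewrite eqxx mulr1 mulr_sumr; apply: eq_bigr => s2 _.
have e1 : theta1 (nth a (a :: s1 ++ s2)) = theta1 (nth a (a :: s1)).
  by apply: loc1 => k km; rewrite nth_path_cat // size_tuple.
have e2 : theta2 (fun k => nth a (a :: s1 ++ s2) (m1 + k)%N) =
    theta2 (nth (nth a (a :: s1) m1) (nth a (a :: s1) m1 :: s2)).
  apply: loc2 => k km; have := @nth_path_catr a s1 s2 k.
  by rewrite !size_tuple; apply.
rewrite e1 e2 mulrA; congr (_ * (_ == _)%:R).
by have := @nth_path_catr a s1 s2 m2; rewrite !size_tuple => ->.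
Qed.

Lemma pathmx1 (M : 'M[F]_N) : M = pathmx 1 (fun v => M (v 0%N) (v 1%N)).
Proof.
apply/matrixP => a b; rewrite mxE.
rewrite (big_tupleS _ (fun s => M (nth a (a :: s) 0) (nth a (a :: s) 1%N) *
    (nth a (a :: s) 1 == b)%:R)).
rewrite (bigD1 b) //= [X in _ + X]big1 => [|c nc]; last first.
  by rewrite (big_tuple0 (fun s => M a c * (c == b)%:R)) (negbTE nc) mulr0.
by rewrite (big_tuple0 (fun s => M a b * (b == b)%:R)) eqxx mulr1 addr0.
Qed.

Lemma pathmx0 : pathmx 0 (fun=> 1) = 1%:M.
Proof.
apply/matrixP => a b; rewrite !mxE.
by rewrite (big_tuple0 (fun s => 1 * (nth a (a :: s) 0 == b)%:R)) mul1r.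
Qed.

Lemma local_letters (M : nat -> 'M[F]_N) m :
  local_to m (fun v => \prod_(j < m) M j (v j) (v j.+1)).
Proof.
move=> v v' vv; apply: eq_bigr => j _.
by rewrite !vv // ltnW.
Qed.

Lemma prod_pathmx (M : nat -> 'M[F]_N) m :
  \prod_(j < m) M j = pathmx m (fun v => \prod_(j < m) M j (v j) (v j.+1)).
Proof.
elim: m => [|m IHm].
  rewrite big_ord0 -[LHS]pathmx0; apply/matrixP => a b; rewrite !mxE.
  by apply: eq_bigr => s _; rewrite big_ord0.
rewrite big_ord_recr /= IHm -[LHS]/(mulmx _ _) {1}(pathmx1 (M m)) pathmxM.
- rewrite addn1; apply/matrixP => a b; rewrite !mxE.
  by apply: eq_bigr => s _; rewrite big_ord_recr /= addn0.
- exact: local_letters.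
- by move=> v v' vv; rewrite !vv.
Qed.

Lemma local_shift o m theta v v' : local_to m theta ->
  (forall k, (k <= o + m)%N -> v k = v' k) ->
  theta (fun k => v (o + k)%N) = theta (fun k => v' (o + k)%N).
Proof. by move=> loc vv; apply: loc => k km; apply: vv; rewrite leq_add2l. Qed.

Lemma prod_blocks_pathmx (p : nat) (mz : nat -> nat) (theta : nat -> (nat -> V) -> F) :
  (forall i, local_to (mz i) (theta i)) ->
  \prod_(i < p) pathmx (mz i) (theta i) =
  pathmx (\sum_(i < p) mz i)
     (fun v => \prod_(i < p) theta i (fun k => v (\sum_(j < i) mz j + k)%N)).
Proof.
move=> loc; have locP q : local_to (\sum_(i < q) mz i)
    (fun v => \prod_(i < q) theta i (fun k => v (\sum_(j < i) mz j + k)%N)).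
  move=> v v' vv; apply: eq_bigr => i _.
  apply: (@local_shift (\sum_(j < i) mz j) _ _ _ _ (loc i)) => k km; apply: vv.
  apply: (leq_trans km).
  rewrite -!(big_mkord xpredT mz) -big_nat_recr //=.
  by rewrite [X in (_ <= X)%N](big_cat_nat (n := i.+1)) //= leq_addr.
elim: p => [|p IHp].
  rewrite !big_ord0 -[LHS]pathmx0; apply/matrixP => a b; rewrite !mxE.
  by apply: eq_bigr => s _; rewrite big_ord0.
rewrite big_ord_recr /= IHp -[LHS]/(mulmx _ _) pathmxM //.
rewrite [\sum_(i < p.+1) _]big_ord_recr /=.
apply/matrixP => a b; rewrite !mxE.
by apply: eq_bigr => s _; rewrite big_ord_recr.
Qed.

End PathSums.

Section TracePath.
Variables (F : comNzRingType) (m : nat).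
Local Notation V := 'I_m.+1.

(** The last vertex of s is also the vertex of index 0. *)
Definition closed_path (s : seq V) : nat -> V := nth ord0 (last ord0 s :: s).

Lemma closed_pathS (s : seq V) k : closed_path s k.+1 = nth ord0 s k.
Proof. by []. Qed.

Lemma closed_path_end (s : seq V) : closed_path s (size s) = closed_path s 0.
Proof. by case: s => // v s; rewrite /closed_path /= nth_last. Qed.

Lemma mxtrace_pathmx n (theta : (nat -> V) -> F) : (0 < n)%N -> local_to n theta ->
  \tr (pathmx n theta) = \sum_(s : n.-tuple V) theta (closed_path s).
Proof.
move=> n0 loc; rewrite /mxtrace.
under eq_bigr do rewrite mxE.
rewrite exchange_big /=; apply: eq_bigr => s _.
have E a k : (k <= n)%N -> nth a (a :: s) k = nth ord0 (a :: s) k.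
  by move=> kn; apply: set_nth_default; rewrite /= size_tuple.
have last_n a : nth a (a :: s) n = last ord0 s.
  rewrite E // -[X in nth _ _ X](prednK n0) /=.
  by have := nth_last ord0 s; rewrite size_tuple.
rewrite (bigD1 (last ord0 s)) //= big1 ?addr0 => [|a na]; last first.
  by rewrite last_n eq_sym (negbTE na) mulr0.
rewrite last_n eqxx mulr1; apply: loc => k kn.
exact: E.
Qed.

End TracePath.

(** * The genus bound on the circle *)

Section AlternatingSums.
Variable V : zmodType.
Implicit Types (u v : nat -> V).

Definition alt_sum u b : V := \sum_(t < b) (if odd t then - u t else u t).

Lemma alt_sumS u b : alt_sum u b.+1 = alt_sum u b + (if odd b then - u b else u b).
Proof. by rewrite /alt_sum big_ord_recr. Qed.

Lemma alt_sumD u v b : alt_sum (fun t => u t + v t) b = alt_sum u b + alt_sum v b.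
Proof.
rewrite /alt_sum -big_split /=; apply: eq_bigr => t _.
by case: ifP => _ //; rewrite opprD.
Qed.

(** Omitting the last term when b is odd makes the values on functions constant
    along even or odd steps depend on u 0 and u b only. *)
Definition trimmed_alt_sum u b : V := alt_sum u b - (if odd b then u b else 0).

Lemma trimmed_alt_sumD u v b : trimmed_alt_sum (fun t => u t + v t) b =
    trimmed_alt_sum u b + trimmed_alt_sum v b.
Proof.
rewrite /trimmed_alt_sum alt_sumD; case: odd; last by rewrite !subr0.
by rewrite opprD addrACA.
Qed.

(** Equal terms cancel in pairs, starting at 0. *)
Lemma trimmed_alt_sum_even_steps u M b :
  (forall t, (t.+1 < M)%N -> ~~ odd t -> u t = u t.+1) -> (b < M)%N ->
  trimmed_alt_sum u b = 0.
Proof.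
move=> uE bM; rewrite /trimmed_alt_sum.
suff -> : alt_sum u b = if odd b then u b else 0 by rewrite subrr.
elim: b bM => [|b IHb] bM; first by rewrite /alt_sum big_ord0.
rewrite alt_sumS IHb ?(ltnW bM) //=; case: (boolP (odd b)) => ob /=.
  by rewrite subrr.
by rewrite add0r (uE b).
Qed.

(** Equal terms cancel in pairs, starting at 1. *)
Lemma trimmed_alt_sum_odd_steps u M b :
  (forall t, (t.+1 < M)%N -> odd t -> u t = u t.+1) -> (b < M)%N ->
  trimmed_alt_sum u b = u 0%N - u b.
Proof.
move=> uE bM; rewrite /trimmed_alt_sum.
suff -> : alt_sum u b = u 0%N - if odd b then 0 else u b.
  by case: odd; rewrite ?subr0 ?addr0.
elim: b bM => [|b IHb] bM; first by rewrite /alt_sum big_ord0 subrr.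
rewrite alt_sumS IHb ?(ltnW bM) //=; case: (boolP (odd b)) => ob /=.
  by rewrite subr0 (uE b).
by rewrite subrK subr0.
Qed.

End AlternatingSums.

Section Circle.
Variables (m n : nat).
Local Notation V := 'I_m.+1.
Local Notation Pt := 'I_(n.*2).
Variable tau : Pt -> Pt.
Hypothesis tauK : involutive tau.
Hypothesis tau_neq : forall x, tau x != x.

(** The points 2j and 2j + 1 of the circle are the two ends of the letter j. *)
Definition edge (x : Pt) : nat := x./2.
(** The points 2j - 1 and 2j are the neighbouring ends of consecutive letters; the
    reduction modulo n closes the circle. *)
Definition vertex (x : Pt) : nat := uphalf x %% n.

Definition const_on (k : Pt -> nat) : {set {ffun Pt -> V}} :=
  [set u : {ffun Pt -> V} | [forall x, forall y, (k x == k y) ==> (u x == u y)]].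
Definition tau_inv : {set {ffun Pt -> V}} := [set u : {ffun Pt -> V} | [forall x,
    u (tau x) == u x]].

Lemma const_onP k (u : {ffun Pt -> V}) :
  reflect (forall x y, k x = k y -> u x = u y) (u \in const_on k).
Proof.
rewrite inE; apply: (iffP forallP) => [H x y kxy|H x].
  by have /forallP/(_ y)/implyP/(_ (introT eqP kxy))/eqP := H x.
by apply/forallP => y; apply/implyP => /eqP /H ->.
Qed.

Lemma tau_invP (u : {ffun Pt -> V}) :
  reflect (forall x, u (tau x) = u x) (u \in tau_inv).
Proof. by rewrite inE; apply: (iffP forallP) => H x; apply/eqP/H. Qed.

(** Alternating sums run over natural numbers. *)
Definition nat_ext (u : {ffun Pt -> V}) (t : nat) : V :=
  if insub t is Some x then u x else 0.

Lemma nat_extE u (x : Pt) : nat_ext u x = u x.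
Proof. by rewrite /nat_ext valK. Qed.

Lemma nat_extS (u : {ffun Pt -> V}) t (ht : (t < n.*2)%N) (ht' : (t.+1 < n.*2)%N) :
  u (Ordinal ht) = u (Ordinal ht') -> nat_ext u t = nat_ext u t.+1.
Proof. by rewrite -!nat_extE. Qed.

Lemma nat_ext_edge u t : u \in const_on edge -> (t.+1 < n.*2)%N -> ~~ odd t ->
  nat_ext u t = nat_ext u t.+1.
Proof.
move=> /const_onP uE ht ot; apply: (@nat_extS u t (ltnW ht) ht); apply: uE.
by rewrite /edge /= uphalf_half (negbTE ot).
Qed.

Lemma nat_ext_vertex u t : u \in const_on vertex -> (t.+1 < n.*2)%N -> odd t ->
  nat_ext u t = nat_ext u t.+1.
Proof.
move=> /const_onP uE ht ot; apply: (@nat_extS u t (ltnW ht) ht); apply: uE.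
by rewrite /vertex /= uphalf_half ot add1n.
Qed.

(** An invariant function is determined by its values at the smaller points of the
    n pairs. *)
Lemma card_tau_inv : (#|tau_inv| <= m.+1 ^ n)%N.
Proof.
pose A : {set Pt} := [set x : Pt | (x < tau x)%N].
have cA : #|A| = n.
  have cAC : (#|A| + #|~: A| = n.*2)%N by rewrite cardsC card_ord.
  suff cAA : #|~: A| = #|A|.
    by apply: double_inj; rewrite -[RHS]cAC cAA addnn.
  apply/esym; rewrite -(card_imset A (inv_inj tauK)).
  apply: eq_card => x; apply/imsetP/idP => [[y + ->]|].
    by rewrite !inE tauK -leqNgt => /ltnW.
  rewrite !inE -leqNgt leq_eqVlt => /orP[/eqP/val_inj E|xt].
    by have := tau_neq x; rewrite E eqxx.
  by exists (tau x); rewrite ?inE ?tauK.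
pose h (u : {ffun Pt -> V}) : {ffun Pt -> V} := [ffun x => if x \in A then u x else 0].
have h_inj : {in tau_inv &, injective h}.
  move=> u v /tau_invP ut /tau_invP vt /ffunP uv; apply/ffunP => x.
  have [xA|xA] := boolP (x \in A); first by have := uv x; rewrite !ffunE xA.
  have txA : tau x \in A.
    move: xA; rewrite !inE tauK -leqNgt leq_eqVlt => /orP[/eqP/val_inj E|//].
    by have := tau_neq x; rewrite E eqxx.
  by have := uv (tau x); rewrite !ffunE txA ut vt.
pose S : {set V} := [set: V].
have -> : (m.+1 ^ n = #|pffun_on (ord0 : V) (mem A) (mem S)|)%N.
  by rewrite card_pffun_on cardsT card_ord cA.
rewrite -(card_in_imset h_inj).
apply: subset_leq_card; apply/fintype.subsetP => u /imsetP[v _ ->].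
apply/pffun_onP; split; last by move=> x; rewrite inE.
by apply/fintype.subsetP => x; rewrite inE ffunE; case: ifP => // _; rewrite eqxx.
Qed.

(** The strict form of the genus bound #(delta,tau) + #(sigma,tau) <= n + 1, with
    functions counted instead of orbits. *)
Lemma circle_crossing_bound (x y z : Pt) :
  tau x = y -> (x < z < y)%N -> (tau z < x)%N || (y < tau z)%N ->
  (#|const_on edge :&: tau_inv| * #|const_on vertex :&: tau_inv| <= m.+1 ^ n)%N.
Proof.
move=> txy /andP[xz zy] tz.
(* The homomorphism that kills the sums of the two kinds of invariant functions.  It
   vanishes on the first kind by pairwise cancellation; on the second kind it is
   u x - u y, which vanishes as y = tau x. *)
pose ell (u : {ffun Pt -> V}) : V := trimmed_alt_sum (nat_ext u) y -
    trimmed_alt_sum (nat_ext u) x.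
have nat_extD u v : nat_ext (u + v) =1 fun t => nat_ext u t + nat_ext v t.
  by move=> t; rewrite /nat_ext; case: insubP => [w _ _|_]; rewrite ?ffunE ?addr0.
have ellD u v : ell (u + v) = ell u + ell v.
  have E b : trimmed_alt_sum (nat_ext (u + v)) b = trimmed_alt_sum (nat_ext u) b
      + trimmed_alt_sum (nat_ext v) b.
    by rewrite -trimmed_alt_sumD /trimmed_alt_sum /alt_sum nat_extD; congr (_ - _);
       apply: eq_bigr => t _; rewrite nat_extD.
  by rewrite /ell !E opprD addrACA.
have ell_edge u : u \in const_on edge -> ell u = 0.
  move=> uE; rewrite /ell !(@trimmed_alt_sum_even_steps _ _ n.*2) ?subrr //;
    by move=> t; exact: nat_ext_edge.
have ell_vertex u : u \in const_on vertex :&: tau_inv -> ell u = 0.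
  rewrite inE => /andP[uE /tau_invP ut].
  rewrite /ell !(@trimmed_alt_sum_odd_steps _ _ n.*2) //;
    try by move=> t; exact: nat_ext_vertex.
  by rewrite !nat_extE -txy ut subrr.
(* Exactly one of z and tau z lies between x and y, so ell sends e r to r or -r. *)
pose e (r : V) : {ffun Pt -> V} := [ffun t => if (t == z) || (t == tau z) then r
    else 0].
have e_tau r : e r \in tau_inv.
  apply/tau_invP => t; rewrite !ffunE (inj_eq (inv_inj tauK)).
  suff -> : (tau t == z) = (t == tau z) by rewrite orbC.
  by apply/eqP/eqP => [<-|->]; rewrite tauK.
have ell_e r : ell (e r) = if odd z then - r else r.
  have zx : z != x by rewrite -val_eqE /= gtn_eqF.
  have zy' : z != y by rewrite -val_eqE /= ltn_eqF.
  have tzx : x != tau z by apply: contra_neq zy' => E; rewrite -txy E tauK.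
  have tzy : y != tau z by rewrite -txy (inj_eq (inv_inj tauK)) eq_sym.
  have ex : nat_ext (e r) x = 0 by rewrite nat_extE ffunE eq_sym (negbTE zx)
      (negbTE tzx).
  have ey : nat_ext (e r) y = 0 by rewrite nat_extE ffunE eq_sym (negbTE zy')
      (negbTE tzy).
  rewrite /ell /trimmed_alt_sum ex ey !if_same !subr0 /alt_sum.
  rewrite -!(big_mkord xpredT (fun t => if odd t then - nat_ext (e r) t else
      nat_ext (e r) t)).
  rewrite (big_cat_nat_idem _ (n := x)) ?(ltnW (ltn_trans xz zy)) //=; last
      exact: addr0.
  rewrite addrAC subrr add0r.
  rewrite (big_cat_nat_idem _ (n := z)) ?(ltnW xz) ?(ltnW zy) //=; last exact: addr0.
  rewrite [X in _ + X]big_ltn // nat_extE ffunE eqxx /=.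
  have e0 t : (x <= t < y)%N -> t != z -> (if odd t then - nat_ext (e r) t else
      nat_ext (e r) t) = 0.
    move=> /andP[xt ty] tz'; have tn : (t < n.*2)%N by exact: ltn_trans ty (ltn_ord y).
    suff -> : nat_ext (e r) t = 0 by rewrite oppr0 if_same.
    rewrite -[t]/(val (Ordinal tn)) nat_extE ffunE -!val_eqE /= (negbTE tz') /=.
    case: eqP => // E; move: tz; rewrite -E.
    by rewrite ltnNge xt /= ltnNge (ltnW ty).
  rewrite big_nat big1 => [|t /andP[xt tz']]; last first.
    by rewrite e0 ?xt ?(ltn_trans tz' zy) // ltn_eqF.
  rewrite add0r big_nat big1 ?addr0 // => t /andP[zt ty].
  by rewrite e0 ?ty ?(leq_trans (ltnW xz) (ltnW zt)) // gtn_eqF.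
pose K : {set {ffun Pt -> V}} := [set u : {ffun Pt -> V} in tau_inv | ell u == 0].
pose x0 : Pt := Ordinal (leq_ltn_trans (leq0n x) (ltn_ord x)).
(* Two decompositions of a sum differ by a function invariant under delta and sigma,
   that is, by a constant; the value of u at 0 determines it. *)
have le1 : (#|const_on edge :&: tau_inv| * #|const_on vertex :&: tau_inv| <= m.+1
    * #|K|)%N.
  have -> : (m.+1 * #|K| = #|finset.setX [set: V] K|)%N by rewrite cardsX cardsT
      card_ord.
  rewrite -cardsX.
  pose h (uv : {ffun Pt -> V} * {ffun Pt -> V}) := (uv.1 x0, uv.1 + uv.2).
  rewrite -(card_in_imset (f := h)).
    apply: subset_leq_card; apply/fintype.subsetP => _ /imsetP[[u v] uvP ->].
    move: uvP; rewrite finset.in_setX /= => /andP[uP vP]; rewrite finset.in_setX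
        finset.in_setT /=.
    have /andP[uE ut] : (u \in const_on edge) && (u \in tau_inv) by move: uP;
        rewrite inE.
    have vt : v \in tau_inv by move: vP; rewrite inE => /andP[].
    rewrite inE ellD ell_edge // ell_vertex // addr0 eqxx andbT.
    by apply/tau_invP => t; rewrite !ffunE (tau_invP _ ut) (tau_invP _ vt).
  move=> [u v] [u' v']; rewrite !finset.in_setX /=.
  move=> /andP[uP vP] /andP[uP' vP'] [u0 /ffunP uv].
  have edgeP w : w \in const_on edge :&: tau_inv -> w \in const_on edge.
    by rewrite inE => /andP[].
  have vertP w : w \in const_on vertex :&: tau_inv -> w \in const_on vertex.
    by rewrite inE => /andP[].
  have w0 t : nat_ext u t - nat_ext u' t = 0.
    have [tn|tn] := ltnP t n.*2; last first.
      by rewrite /nat_ext insubN ?subrr // -leqNgt.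
    elim: t tn => [|t IHt] tn.
      by rewrite -[0%N]/(val x0) !nat_extE u0 subrr.
    rewrite -(IHt (ltnW tn)); have [ot|ot] := boolP (odd t); last first.
      by rewrite (nat_ext_edge (edgeP _ uP) tn ot) (nat_ext_edge (edgeP _ uP') tn ot).
    have E s : nat_ext u s - nat_ext u' s = nat_ext v' s - nat_ext v s.
      have [sn|sn] := ltnP s n.*2; last by rewrite /nat_ext !insubN -?leqNgt.
      rewrite -[s]/(val (Ordinal sn)) !nat_extE; have := uv (Ordinal sn).
      rewrite !ffunE => E; have -> : u (Ordinal sn) = u' (Ordinal sn) + v'
          (Ordinal sn) - v (Ordinal sn).
        by rewrite -E addrK.
      by rewrite addrAC (addrC (u' _)) addrK.
    by rewrite !E (nat_ext_vertex (vertP _ vP) tn ot) (nat_ext_vertex (vertP _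
        vP') tn ot).
  have uu : u = u'.
    by apply/ffunP => t; have /eqP := w0 t; rewrite !nat_extE subr_eq0 => /eqP.
  congr (_, _) => //; apply/ffunP => t; have := uv t.
  by rewrite !ffunE uu => /addrI.
(* Translation of the kernel by the functions e r. *)
have le2 : (m.+1 * #|K| <= #|tau_inv|)%N.
  have -> : (m.+1 * #|K| = #|finset.setX [set: V] K|)%N by rewrite cardsX cardsT
      card_ord.
  pose h (rv : V * {ffun Pt -> V}) := rv.2 + e rv.1.
  rewrite -(card_in_imset (f := h)).
    apply: subset_leq_card; apply/fintype.subsetP => _ /imsetP[[r u] + ->].
    rewrite inE /= => /andP[_]; rewrite inE => /andP[/tau_invP ut _].
    apply/tau_invP => t; rewrite /h !ffunE ut.
    by have /tau_invP/(_ t) := e_tau r; rewrite !ffunE => ->.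
  move=> [r u] [r' u'] /=; rewrite !inE /= => /andP[_ /eqP lu] /andP[_ /eqP lu'].
  rewrite /h /= => E; have := congr1 ell E.
  rewrite !ellD lu lu' !add0r !ell_e => rr'.
  have {}rr' : r = r' by move: rr'; case: odd => // /oppr_inj.
  by move: E; rewrite rr' => /addIr ->.
exact: leq_trans le1 (leq_trans le2 card_tau_inv).
Qed.

End Circle.

(** * Counting functions invariant under a premap *)

Section HalfCycles.
Variables (T : finType) (m : nat) (pi : {perm T}) (dl : T -> T).
Local Notation V := 'I_m.+1.
Hypothesis dlK : involutive dl.
Hypothesis pi_dl : forall x, pi (dl (pi x)) = dl x.
Hypothesis dl_notin : forall x, dl x \notin porbit pi x.

Definition both_inv : {set {ffun T -> V}} :=
  [set u : {ffun T -> V} | [forall x, (u (dl x) == u x) && (u (pi x) == u x)]].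

(** The cycles of pi come in pairs exchanged by dl, and a function invariant under
    pi alone is a pair of functions invariant under pi and dl: its values on one
    cycle of each pair, and its values on the other. *)
Lemma half_cycles_bound : (m.+1 ^ #|porbits pi| <= #|both_inv| ^ 2)%N.
Proof.
have pd x : porbit pi (dl (pi x)) = porbit pi (dl x).
  by rewrite -(pi_dl x); apply/esym; exact: (porbit_perm pi 1).
have pp x : porbit pi (pi x) = porbit pi x by exact: (porbit_perm pi 1).
(* An arbitrary choice of one cycle in each pair. *)
pose pos x := (enum_rank (porbit pi x) < enum_rank (porbit pi (dl x)))%N.
have pos_dl x : pos (dl x) = ~~ pos x.
  rewrite /pos dlK -leqNgt [RHS]leq_eqVlt; case: eqP => // E.
  have /eqP := enum_rank_inj (val_inj E); by rewrite eq_porbit_mem (negbTE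
      (dl_notin x)).
have pos_pi x : pos (pi x) = pos x by rewrite /pos pd pp.
pose S : {set V} := [set: V].
pose h (g : {ffun {set T} -> V}) : {ffun T -> V} * {ffun T -> V} :=
  ([ffun x => if pos x then g (porbit pi x) else g (porbit pi (dl x))],
   [ffun x => if pos x then g (porbit pi (dl x)) else g (porbit pi x)]).
have -> : (m.+1 ^ #|porbits pi| = #|pffun_on (ord0 : V) (mem (porbits pi)) (mem S)|)%N.
  by rewrite card_pffun_on cardsT card_ord.
rewrite -mulnn -cardsX -(card_in_imset (f := h)).
  apply: subset_leq_card; apply/fintype.subsetP => _ /imsetP[g _ ->].
  rewrite finset.in_setX /= !inE; apply/andP; split; apply/forallP => x;
    by rewrite !ffunE pos_dl pos_pi dlK pd pp; case: (pos x); rewrite !eqxx.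
move=> g g' /pffun_onP[/fintype.subsetP gs _] /pffun_onP[/fintype.subsetP gs' _].
move=> [/ffunP g1 /ffunP g2]; apply/ffunP => O.
have [/imsetP[x _ ->]|nO] := boolP (O \in porbits pi).
  by have := g1 x; have := g2 x; rewrite !ffunE; case: (pos x).
have gO : g O = ord0 by apply/eqP; apply: contraNT nO; exact: gs.
have gO' : g' O = ord0 by apply/eqP; apply: contraNT nO; exact: gs'.
by rewrite gO gO'.
Qed.

End HalfCycles.

(** * Existence of a crossing *)

Section Crossing.
Variables (M p C : nat) (tau : 'I_M -> 'I_M) (block_of : 'I_M -> nat) (w : nat -> 'I_C).
Hypothesis tauK : involutive tau.
Hypothesis p0 : (0 < p)%N.
Hypothesis block_of_mono : forall x y : 'I_M, (x <= y)%N -> (block_of x <=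
    block_of y)%N.
Hypothesis block_lt : forall x, (block_of x < p)%N.
Hypothesis w_tau : forall x, w (block_of (tau x)) = w (block_of x).
Hypothesis w_alt : forall b, (b.+1 < p)%N -> w b != w b.+1.
Hypothesis not_isolated : forall b, (b < p)%N ->
  exists2 x, block_of x = b & block_of (tau x) != b.

(** A pair {x, tau x} between two blocks at minimal distance joins non-adjacent
    blocks, as tau preserves colours.  The block following that of x is joined to
    some other block, which by minimality is not between those of x and tau x. *)
Lemma exists_crossing : exists x z : 'I_M, (x < z < tau x)%N &&
  ((tau z < x)%N || (tau x < tau z)%N).
Proof.
have ltP (x y : 'I_M) : (block_of x < block_of y)%N -> (x < y)%N.
  by move=> lt_xy; rewrite ltnNge; apply: contraL lt_xy => /block_of_mono;
      rewrite -leqNgt.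
have [x1 x1b x1t] := not_isolated p0.
pose Q (x : 'I_M) := (block_of x < block_of (tau x))%N.
have Qsome : exists x, Q x.
  have [lt|lt|E] := ltngtP (block_of x1) (block_of (tau x1)); first by exists x1.
    by exists (tau x1); rewrite /Q tauK.
  by move: x1t; rewrite -E x1b eqxx.
have [x0 Qx0] := Qsome.
pose dist (x : 'I_M) := (block_of (tau x) - block_of x)%N.
pose x := [arg min_(x < x0 | Q x) dist x].
have [Qx xmin] : Q x /\ forall z, Q z -> (dist x <= dist z)%N.
  by rewrite /x; case: arg_minnP.
have lt1 : ((block_of x).+1 < block_of (tau x))%N.
  rewrite ltn_neqAle (Qx : (block_of x < block_of (tau x))%N) andbT; apply/eqP => E.
  have := w_alt (b := block_of x); rewrite E => /(_ (block_lt _)).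
  by rewrite w_tau eqxx.
have [z zb zt] := not_isolated (ltn_trans lt1 (block_lt _)).
exists x, z; apply/andP; split; first by apply/andP; split; apply: ltP; rewrite zb.
have [lt|lt|E] := ltngtP (block_of z) (block_of (tau z)).
- have := xmin z lt; rewrite /dist zb => le.
  by apply/orP; right; apply: ltP; move: le lt lt1 Qx; rewrite /Q zb; lia.
- have Qt : Q (tau z) by rewrite /Q tauK.
  have := xmin _ Qt; rewrite /dist tauK zb => le.
  by apply/orP; left; apply: ltP; move: le lt lt1 Qx; rewrite /Q zb; lia.
- by move: zt; rewrite -E zb eqxx.
Qed.

End Crossing.

(** * Expectations of words are scalar matrices *)

Section ScalarPath.
Variables (F : numFieldType) (m : nat).
Local Notation V := 'I_m.+1.

(** The sign s = -1 at a and 1 elsewhere shows that paths from a to b <> a have total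
    weight 0; exchanging two indices shows that the diagonal entries agree. *)
Lemma pathmx_scalar n (theta : (nat -> V) -> F) :
  local_to n theta ->
  (forall (r : V -> V) v, injective r -> theta (r \o v) = theta v) ->
  (forall (s : V -> F) v, (forall a, s a * s a = 1) ->
     theta v * (s (v 0%N) * s (v n)) = theta v) ->
  pathmx n theta = (pathmx n theta ord0 ord0)%:M.
Proof.
move=> loc relabel sign; apply/matrixP => a b; rewrite [RHS]mxE.
case: eqVneq => [<-|nab]; rewrite ?mulr1n ?mulr0n.
  rewrite !mxE.
  pose r := tperm ord0 a.
  rewrite (reindex_inj (h := fun s : n.-tuple V => [tuple of map r s])); last first.
    by move=> s s' /(congr1 val)/= /(inj_map perm_inj) ss; apply: val_inj.
  apply: eq_bigr => s _.
  have E k : (k <= n)%N -> nth a (a :: [tuple of map r s]) k = r (nth ord0 (ord0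
      :: s) k).
    case: k => [|k] kn /=; first by rewrite tpermL.
    by rewrite (nth_map ord0) ?size_tuple.
  rewrite E // (loc _ (r \o nth ord0 (ord0 :: s))) // relabel; last exact: perm_inj.
  by rewrite -[in RHS](inj_eq (@perm_inj _ r) _ ord0) tpermL.
rewrite mxE big1 // => s _; case: eqP => [sb|_]; last by rewrite mulr0.
pose sg (c : V) : F := if c == a then -1 else 1.
have sg2 c : sg c * sg c = 1 by rewrite /sg; case: ifP; rewrite ?mulrNN mulr1.
have := sign sg (nth a (a :: s)) sg2; rewrite sb /= /sg eqxx eq_sym (negbTE nab) mulr1.
by rewrite mulrN1 mulr1 => /eqP; rewrite eq_sym -addr_eq0 -mulr2n mulrn_eq0 /= => /eqP.
Qed.

End ScalarPath.

Section Symmetry.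
Variables (d : measure_display) (R : realType).
Variables (T : nat -> measurableType d) (P : forall N, probability (T N) R).
Variables (L : Type) (X : forall N, L -> T N -> 'M[R[i]]_N).
Variable PM : forall I : {fset int}, {set {perm (pm I)}}.
Variable f : nat -> forall I : {fset int}, (int -> L) -> {perm (pm I)} -> R[i].
Hypothesis GX : condG P X PM f.
Variables (N : nat) (lam : int -> L).
Hypothesis N0 : (0 < N)%N.

(** Each pair {x, - p(x)} contributes the square of a sign. *)
Lemma compatible_sign (phi : int -> 'I_N) (I : {fset int}) (p : {perm (pm I)})
    (s : 'I_N -> R[i]) : posset I -> p \in premap I -> compatible phi p ->
  (forall a, s a * s a = 1) ->
  \prod_(k <- I) (s (phi k) * s (phi (- k))) = 1.
Proof.
move=> I0 pI /forallP pphi s2.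
have -> : \prod_(k <- I) (s (phi k) * s (phi (- k))) = \prod_(k <- pm I) s (phi k).
  rewrite big_split /= -(big_map -%R xpredT (fun k => s (phi k))) -big_cat.
  apply: perm_big; apply: uniq_perm.
  - rewrite cat_uniq fset_uniq (map_inj_uniq oppr_inj) fset_uniq andbT /=.
    apply/hasPn => _ /mapP[k kI ->]; apply/negP => /I0.
    by rewrite oppr_gt0 ltNge ltW // I0.
  - exact: fset_uniq.
  - move=> k; rewrite mem_cat !inE; congr (_ || _).
    by apply/mapP/imfsetP => -[j jI ->]; exists j.
rewrite big_seq_fsetE /= (bigID (particular p)) /=.
have dp_inj : injective (fun x => delta I (p x)).
  by move=> x y /(inv_inj (@deltaK I))/perm_inj.
rewrite [X in _ * X](reindex_inj dp_inj) /=.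
rewrite [X in _ * X](eq_big (particular p) (fun x => s (phi (val x)))).
- by rewrite -big_split /= big1 // => x _; exact: s2.
- by move=> x; rewrite particular_delta // particular_perm negbK.
- by move=> x _; rewrite deltaE (eqP (pphi x)).
Qed.

Lemma cexp_entry_product_sign (phi : int -> 'I_N) (I : {fset int}) (s : 'I_N -> R[i]) :
  posset I -> (forall a, s a * s a = 1) ->
  cexp (P N) (entry_product X lam phi I) * \prod_(k <- I) (s (phi k) * s (phi (- k))) =
  cexp (P N) (entry_product X lam phi I).
Proof.
move=> I0 s2; rewrite (entry_product_expansion GX) // mulr_suml; apply: eq_bigr => p pP.
rewrite /premap_weight; case: (boolP (compatible phi p)) => cp; last by rewrite
    mulr0 mul0r.
by rewrite (compatible_sign I0 (PM_premap GX I0 pP) cp s2) mulr1.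
Qed.

Lemma cexp_entry_product_relabel (phi : int -> 'I_N) (I : {fset int}) (r : 'I_N
    -> 'I_N) :
  posset I -> injective r ->
  cexp (P N) (entry_product X lam (r \o phi) I) = cexp (P N) (entry_product X lam
      phi I).
Proof.
move=> I0 r_inj; rewrite !(entry_product_expansion GX) //; apply: eq_bigr => p _.
congr (_ * (_)%:R); congr nat_of_bool; apply: eq_forallb => x.
by rewrite /= (inj_eq r_inj).
Qed.

End Symmetry.

(** * Words as blocks of consecutive positions *)

Section PositionSets.
Implicit Types (s : seq nat).

(** The position k (counted from 0) is the letter k + 1, so that it has a sign. *)
Definition pos_set s : {fset int} := [fset Posz k.+1 | k in s]%fset.

Lemma pos_setP s z : reflect (exists2 k, k \in s & z = Posz k.+1) (z \in pos_set s).
Proof. exact: imfsetP. Qed.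

Lemma in_pos_set s k : (Posz k.+1 \in pos_set s) = (k \in s).
Proof.
apply/pos_setP/idP => [[l ls [->]] //|ks]; by exists k.
Qed.

Lemma posset_pos_set s : posset (pos_set s).
Proof. by move=> z /pos_setP[k _ ->]. Qed.

Lemma in_pm_pos_set s z : (z \in pm (pos_set s)) = (z != 0) && ((absz z).-1 \in s).
Proof.
rewrite (in_pm _ (@posset_pos_set s)) -abszE.
case: (absz z) (absz_eq0 z) => [|k] <- /=; last by rewrite in_pos_set.
by apply/negbTE/negP => /pos_setP[k _].
Qed.

Lemma big_pos_set (F : comPzSemiRingType) s (G : int -> F) : uniq s ->
  \prod_(z <- pos_set s) G z = \prod_(k <- s) G (Posz k.+1).
Proof.
move=> us; rewrite -(big_map (fun k => Posz k.+1) xpredT G).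
apply: perm_big; apply: uniq_perm.
- exact: fset_uniq.
- by rewrite map_inj_uniq // => k l [].
- by move=> z; apply/pos_setP/mapP.
Qed.

Lemma card_pos_set s : uniq s -> #|` pos_set s| = size s.
Proof.
move=> us; rewrite card_imfset /=; last by move=> k l [].
by rewrite undup_id.
Qed.

Lemma premap_ext (I : {fset int}) (p : {perm (pm I)}) k : p \in premap I ->
  k \in pm I -> extp p (- extp p k) = - k.
Proof.
move=> pI kI; have /(congr1 val) := premap_delta pI (Sub k kI).
by rewrite -extpE !deltaE -extpE SubK.
Qed.

End PositionSets.

Section Blocks.
Variables (C p : nat) (mz : nat -> nat) (w : nat -> 'I_C).
Hypothesis p0 : (0 < p)%N.
Hypothesis mz0 : forall i, (i < p)%N -> (0 < mz i)%N.
Hypothesis w_alt : forall b, (b.+1 < p)%N -> w b != w b.+1.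

Definition block_start i : nat := (\sum_(j < i) mz j)%N.
Local Notation n := (block_start p).
Definition block_of k : nat := find (fun i => k < block_start i.+1)%N (iota 0 p).

Lemma block_startS i : block_start i.+1 = (block_start i + mz i)%N.
Proof. by rewrite /block_start big_ord_recr. Qed.

Lemma block_start_mono i j : (i <= j)%N -> (block_start i <= block_start j)%N.
Proof.
elim: j => [|j IHj]; first by rewrite leqn0 => /eqP ->.
rewrite leq_eqVlt => /orP[/eqP -> //|/IHj le]; rewrite block_startS.
exact: leq_trans le (leq_addr _ _).
Qed.

Lemma block_of_bounds k : (k < n)%N ->
  (block_of k < p)%N /\ (block_start (block_of k) <= k < block_start (block_of k).+1)%N.
Proof.
move=> kn; have hs : has (fun i => k < block_start i.+1)%N (iota 0 p).
  apply/hasP; exists p.-1; last by rewrite prednK.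
  by rewrite mem_iota add0n prednK // leqnn.
have lt := hs; rewrite has_find size_iota in lt.
split=> //; apply/andP; split; last first.
  by have := nth_find 0 hs; rewrite nth_iota.
have bf i : (i < block_of k)%N -> (block_start i.+1 <= k)%N.
  move=> ib; have := before_find 0 ib; rewrite nth_iota ?(ltn_trans ib lt) //.
  by rewrite add0n => /negbT; rewrite -leqNgt.
case E : (block_of k) => [|i]; first by rewrite /block_start big_ord0.
by apply: bf; rewrite E.
Qed.

Lemma block_ofE i k : (i < p)%N -> (block_start i <= k < block_start i.+1)%N ->
    block_of k = i.
Proof.
move=> ip /andP[ik ki]; have kn : (k < n)%N := leq_trans ki (block_start_mono ip).
have [bp /andP[bk kb]] := block_of_bounds kn.
apply/eqP; rewrite eqn_leq; apply/andP; split; rewrite leqNgt; apply/negP => lt.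
  by have := leq_trans ki (leq_trans (block_start_mono lt) bk); rewrite ltnn.
by have := leq_trans kb (leq_trans (block_start_mono lt) ik); rewrite ltnn.
Qed.

Lemma block_of_mono k l : (k <= l)%N -> (l < n)%N -> (block_of k <= block_of l)%N.
Proof.
move=> kl ln; have [_ /andP[bk _]] := block_of_bounds (leq_ltn_trans kl ln).
have [_ /andP[_ lb]] := block_of_bounds ln; rewrite leqNgt; apply/negP => lt.
by have := leq_trans lb (leq_trans (block_start_mono lt) (leq_trans bk kl));
    rewrite ltnn.
Qed.

Lemma mem_block i k : (i < p)%N -> (k \in iota (block_start i) (mz i)) = (k <
    n)%N && (block_of k == i).
Proof.
move=> ip; rewrite mem_iota -block_startS; apply/idP/andP => [kb|[kn /eqP <-]].
  by rewrite (block_ofE ip kb) eqxx; split=> //; case/andP: kb => _ /leq_trans;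
      apply; exact: block_start_mono.
by have [_ ->] := block_of_bounds kn.
Qed.

Lemma letter_count_gt0 : (0 < n)%N.
Proof.
rewrite -(prednK p0) block_startS; apply: leq_trans (leq_addl _ _).
by apply: mz0; rewrite prednK.
Qed.

Definition block_set i : {fset int} := pos_set (iota (block_start i) (mz i)).
Definition color_set c : {fset int} :=
  pos_set [seq k <- iota 0 n | w (block_of k) == c].
Definition letter_set : {fset int} := pos_set (iota 0 n).

Definition int_color (z : int) : 'I_C := w (block_of (absz z).-1).

(** The position k leads from v k to v (k + 1): these are the row index, carried by
    the letter k + 1, and the column index, carried by its opposite.  As
    [Negz k] is - (k + 1), both cases shift the index. *)
Definition int_path (V : Type) (v : nat -> V) (z : int) : V :=
  match z with Posz k => v k.-1 | Negz k => v k.+1 end.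

Section Count.
Variable m : nat.
Local Notation V := 'I_m.+1.
Variable pi : forall c, {perm (pm (color_set c))}.
Hypothesis pi_premap : forall c, pi c \in premap (color_set c).
Hypothesis pi_iso : forall i, (i < p)%N -> ~~ isolated (block_set i) (pi (w i)).

Lemma in_color z c : (z \in pm (color_set c)) = (z \in pm letter_set) &&
    (int_color z == c).
Proof.
by rewrite !in_pm_pos_set mem_filter -andbA; congr andb; rewrite andbC.
Qed.

(** The union of the premaps pi c. *)
Definition color_step z : int := extp (pi (int_color z)) z.

Lemma color_step_color z : z \in pm letter_set ->
  color_step z \in pm letter_set /\ int_color (color_step z) = int_color z.
Proof.
move=> zI; have : color_step z \in pm (color_set (int_color z)).
  by rewrite extp_in in_color zI eqxx.
by rewrite in_color => /andP[-> /eqP].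
Qed.

Definition union_perm : {perm (pm letter_set)} := restp (pm letter_set) color_step.

Lemma extp_union_perm z : z \in pm letter_set -> extp union_perm z = color_step z.
Proof.
move=> zI; rewrite extp_restp ?zI //.
  by move=> l /color_step_color[].
move=> k l kI lI E; have [_ ck] := color_step_color kI; have [_ cl] :=
    color_step_color lI.
have cE : int_color k = int_color l by rewrite -ck E cl.
by move: E; rewrite /color_step cE => /extp_inj.
Qed.

Lemma iter_union_perm z j : z \in pm letter_set ->
  iter j (extp union_perm) z = iter j (extp (pi (int_color z))) z.
Proof.
move=> zI; suff [-> //] : iter j (extp union_perm) z = iter j (extp (pi
    (int_color z))) z
  /\ iter j (extp union_perm) z \in pm (color_set (int_color z)).
elim: j => [|j [E1 E2]] /=; first by rewrite in_color zI eqxx.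
move: (E2); rewrite in_color => /andP[jI /eqP jc].
by rewrite extp_union_perm // /color_step jc extp_in; split=> //; rewrite E1.
Qed.

Lemma int_colorN z : int_color (- z) = int_color z.
Proof. by rewrite /int_color abszN. Qed.

Lemma union_perm_delta (x : pm letter_set) :
  union_perm (delta letter_set (union_perm x)) = delta letter_set x.
Proof.
have xI := valP x; have [gI gc] := color_step_color xI.
have nI : - color_step (val x) \in pm letter_set by rewrite pmN.
apply: val_inj; rewrite -extpE !deltaE -extpE (extp_union_perm xI) (extp_union_perm nI).
rewrite {1}/color_step int_colorN gc; apply: premap_ext => //.
by rewrite in_color xI eqxx.
Qed.

Lemma delta_notin_union_perm (x : pm letter_set) :
  delta letter_set x \notin porbit union_perm x.
Proof.
have xI := valP x; have xc : val x \in pm (color_set (int_color (val x))).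
  by rewrite in_color xI eqxx.
apply/negP => /mem_porbit_iter[j]; rewrite deltaE iter_union_perm // => E.
have /negP := delta_notin (pi_premap (int_color (val x))) (Sub (val x) xc); apply.
by apply/mem_porbit_iter; exists j; rewrite deltaE !SubK.
Qed.

Lemma ncyc_union_perm : ncyc union_perm = (\sum_c ncyc (pi c))%N.
Proof.
apply/eqP; rewrite -(eqr_nat rat) natr_sum ncyc_sum.
rewrite (partition_big int_color xpredT) //=; apply/eqP; apply: eq_bigr => c _.
transitivity (\sum_(k <- pm letter_set | int_color k == c) inv_cycle_length (pi c) k).
  rewrite big_seq_cond [RHS]big_seq_cond; apply: eq_bigr => k /andP[kI /eqP kc].
  apply: eq_inv_cycle_length => // [|j]; first by rewrite in_color kI kc eqxx.
  by rewrite iter_union_perm // kc.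
rewrite ncyc_sum -big_filter; apply: perm_big.
apply: uniq_perm; rewrite ?filter_uniq ?fset_uniq // => k.
by rewrite mem_filter in_color andbC.
Qed.

Lemma half_ncyc_union_perm : (ncyc union_perm = (\sum_c (ncyc (pi c))./2).*2)%N.
Proof.
rewrite ncyc_union_perm -muln2 big_distrl /=; apply: eq_bigr => c _.
rewrite (ncyc_phalf (@posset_pos_set _) (pi_premap c)) doubleK.
by rewrite muln2.
Qed.

(** The letter end at the point t of the circle. *)
Definition circle_int (t : nat) : int := if odd t then Negz t./2 else Posz (t./2).+1.

Lemma absz_circle_int t : absz (circle_int t) = (t./2).+1.
Proof. by rewrite /circle_int; case: ifP. Qed.

Lemma circle_int_neq0 t : circle_int t != 0.
Proof. by rewrite -absz_eq0 absz_circle_int. Qed.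

Lemma in_circle_int s t : (circle_int t \in pm (pos_set s)) = (t./2 \in s).
Proof. by rewrite in_pm_pos_set circle_int_neq0 absz_circle_int. Qed.

Lemma circle_int_in (t : 'I_n.*2) : circle_int t \in pm letter_set.
Proof. by rewrite in_circle_int mem_iota /= add0n ltn_half_double. Qed.

Definition circle_pt (t : 'I_n.*2) : pm letter_set := Sub (circle_int t)
    (circle_int_in t).

Lemma circle_pt_bij : bijective circle_pt.
Proof.
apply: inj_card_bij.
  move=> t t' /(congr1 val); rewrite !SubK => E; apply: val_inj => /=.
  have hE : t./2 = t'./2 by apply/eqP; rewrite -eqSS -!absz_circle_int E.
  rewrite -(odd_double_half t) -(odd_double_half t') hE; congr (nat_of_bool _ + _)%N.
  by move: E; rewrite /circle_int hE; case: odd; case: odd.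
rewrite card_ord -cardfE card_pm; last exact: posset_pos_set.
by rewrite card_pos_set ?iota_uniq // size_iota.
Qed.

(** The left-hand side counts pairs of functions on the circle, as in
    [circle_crossing_bound]. *)
Lemma count_bound :
  (m.+1 ^ (\sum_c (ncyc (pi c))./2) *
   #|[set s : n.-tuple V | [forall c, compatible (int_path (closed_path s)) (pi c)]]|
   <= m.+1 ^ n)%N.
Proof.
have [ka kaK Kka] := circle_pt_bij.
pose dl := delta letter_set.
pose tau (t : 'I_n.*2) := ka (dl (union_perm (circle_pt t))).
have tauE t : circle_pt (tau t) = dl (union_perm (circle_pt t)) by rewrite /tau Kka.
have tauI t : circle_int (tau t) = - extp (pi (int_color (circle_int t)))
    (circle_int t).
  have := congr1 val (tauE t); rewrite SubK deltaE -extpE SubK => ->.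
  by rewrite extp_union_perm ?circle_int_in.
have tauK : involutive tau.
  by move=> t; rewrite {1}/tau tauE union_perm_delta /dl deltaK kaK.
have tau_neq t : tau t != t.
  apply/eqP => E; have := delta_notin_union_perm (circle_pt t).
  rewrite -{1}E tauE /dl deltaK; apply/negP/negPn.
  exact: (mem_porbit _ 1).
pose b (t : 'I_n.*2) := block_of t./2.
have half_lt (t : 'I_n.*2) : (t./2 < n)%N by rewrite ltn_half_double.
have b_lt t : (b t < p)%N by have [] := block_of_bounds (half_lt t).
have b_mono (t t' : 'I_n.*2) : (t <= t')%N -> (b t <= b t')%N.
  by move=> tt; apply: block_of_mono (half_lt _); exact: half_leq.
have int_colorE (t : 'I_n.*2) : int_color (circle_int t) = w (b t).
  by rewrite /int_color absz_circle_int.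
have w_tau t : w (b (tau t)) = w (b t).
  rewrite -!int_colorE tauI int_colorN.
  by have [_] := color_step_color (circle_int_in t).
have in_block i (t : 'I_n.*2) : (i < p)%N ->
    (circle_int t \in pm (block_set i)) = (b t == i).
  by move=> ip; rewrite in_circle_int mem_block // half_lt.
have not_iso i : (i < p)%N -> exists2 t, b t = i & b (tau t) != i.
  move=> ip; have /allPn[z zb] := pi_iso ip.
  have zI : z \in pm letter_set.
    move: zb; rewrite !in_pm_pos_set => /andP[-> /=].
    by rewrite mem_block // mem_iota /= add0n => /andP[->].
  have E : circle_int (ka (Sub z zI)) = z.
    by rewrite -[LHS]/(val (circle_pt _)) Kka.
  have bi : b (ka (Sub z zI)) = i by apply/eqP; rewrite -in_block // E.
  move=> nz; exists (ka (Sub z zI)) => //.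
  by rewrite -in_block // tauI int_colorE bi E pmN.
have [x [z /andP[xzy cross]]] :=
  exists_crossing tauK p0 b_mono b_lt w_tau w_alt not_iso.
have bound := circle_crossing_bound m tauK tau_neq erefl xzy cross.
apply: leq_trans bound; apply: leq_mul.
  have le1 := half_cycles_bound m (@deltaK letter_set) union_perm_delta
      delta_notin_union_perm.
  rewrite -/(ncyc union_perm) half_ncyc_union_perm -muln2 expnM leq_exp2r // in le1.
  apply: (leq_trans le1).
  pose h (u : {ffun pm letter_set -> V}) : {ffun 'I_n.*2 -> V} := [ffun t => u
      (circle_pt t)].
  have h_inj : injective h.
    move=> u v /ffunP uv; apply/ffunP => y; have := uv (ka y).
    by rewrite !ffunE Kka.
  rewrite -(card_imset _ h_inj); apply: subset_leq_card.
  apply/fintype.subsetP => _ /imsetP[u + ->].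
  rewrite inE => /forallP uP; rewrite inE; apply/andP; split.
    apply/const_onP => t t' tt; rewrite !ffunE.
    have [/eqP ->|ne] := boolP (t == t') => //.
    have -> : circle_pt t' = dl (circle_pt t).
      apply: val_inj; rewrite deltaE !SubK /circle_int.
      have ho : odd t' = ~~ odd t.
        apply/eqP; move: ne; apply: contraNT => ho; apply/eqP/val_inj.
        rewrite /= -(odd_double_half t) -(odd_double_half t') -[t./2]/(edge t) tt.
        by congr (nat_of_bool _ + _)%N; move: ho; case: odd; case: odd.
      rewrite ho -[t'./2]/(edge t') -tt /edge; case: odd => //=.
    by have /andP[/eqP -> _] := uP (circle_pt t).
  apply/tau_invP => t; rewrite !ffunE tauE.
  have /andP[/eqP -> _] := uP (union_perm (circle_pt t)).
  by have /andP[_ /eqP ->] := uP (circle_pt t).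
pose h (s : n.-tuple V) : {ffun 'I_n.*2 -> V} :=
  [ffun t : 'I_n.*2 => int_path (closed_path s) (circle_int t)].
have hE s (t : 'I_n.*2) : h s t = closed_path s (uphalf t).
  by rewrite ffunE /circle_int uphalf_half; case: odd.
have h_inj : injective h.
  move=> s s' /ffunP ss; apply: eq_from_tnth => j.
  have jn : (j.*2.+1 < n.*2)%N by rewrite ltn_Sdouble.
  have := ss (Ordinal jn); rewrite !hE /= doubleK !closed_pathS.
  by rewrite !(tnth_nth ord0).
rewrite -(card_imset _ h_inj); apply: subset_leq_card.
apply/fintype.subsetP => _ /imsetP[s + ->].
rewrite inE => /forallP sP; rewrite inE; apply/andP; split.
  have modE (t : 'I_n.*2) : closed_path s (uphalf t) = closed_path s (vertex t).
    rewrite /vertex; have [lt|] := ltnP (uphalf t) n; first by rewrite modn_small.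
    move=> ge; have -> : uphalf t = n.
      apply/eqP; rewrite eqn_leq ge andbT leq_uphalf_double ltnW //.
    by rewrite modnn -closed_path_end size_tuple.
  by apply/const_onP => t t' tt; rewrite !hE !modE tt.
apply/tau_invP => t; rewrite !ffunE tauI.
have tI := circle_int_in t.
have := sP (int_color (circle_int t)); rewrite compatibleE => /allP/(_ (circle_int t)).
by rewrite in_color tI eqxx => /(_ isT)/eqP.
Qed.

End Count.
End Blocks.

(** * Limits *)

Section Limits.
Local Open Scope classical_set_scope.
Lemma cvg_prod_seq (K : numFieldType) (J : Type) (r : seq J) (u : J -> nat -> K^o) :
  (forall j, exists l : K^o, u j @ \oo --> l) ->
  exists l : K^o, (fun N => \prod_(j <- r) u j N : K^o) @ \oo --> l.
Proof.
move=> ul; elim: r => [|j r [l IHr]].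
  by exists 1; under eq_fun do rewrite big_nil; exact: cvg_cst.
have [l' l'P] := ul j; exists (l' * l).
by under eq_fun do rewrite big_cons; exact: (cvgM l'P IHr).
Qed.

Lemma cvg_sum_null (K : numFieldType) (J : Type) (r : seq J) (Q : pred J)
    (u b : J -> nat -> K^o) :
  (forall j, Q j -> exists l : K^o, u j @ \oo --> l) ->
  (forall j, Q j -> b j @ \oo --> (0 : K^o)) ->
  (fun N => \sum_(j <- r | Q j) u j N * b j N : K^o) @ \oo --> (0 : K^o).
Proof.
move=> ul b0; elim: r => [|j r IHr].
  by under eq_fun do rewrite big_nil; exact: cvg_cst.
under eq_fun do rewrite big_cons; case: (boolP (Q j)) => // Qj.
have [l lP] := ul j Qj; have uv : (fun N => u j N * b j N : K^o) @ \oo --> (l * 0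
    : K^o).
  exact: cvgM lP (b0 j Qj).
have H := cvgD uv IHr; rewrite mulr0 addr0 in H; exact: H.
Qed.

(** A positive number of R[i] is real, which reduces the claim to the real case. *)
Lemma cvg_complex_inv_null (R : realType) (b : nat -> R[i]^o) :
  (forall N, 0 <= (b N : R[i]) <= N.+1%:R^-1) -> b @ \oo --> (0 : R[i]^o).
Proof.
move=> bb; apply/cvgr0Pnorm_lt => e e0.
have [r r0 eE] : exists2 r : R, 0 < r & e = r%:C%C.
  by case: e e0 => a c; rewrite ltcE /= => /andP[/eqP -> a0]; exists a.
apply: filterS (near_infty_natSinv_lt (PosNum r0)) => N /= Nr.
have /andP[bN0 bN] := bb N; rewrite ger0_norm //; apply: (le_lt_trans bN).
by rewrite eE -(rmorph_nat (real_complex R)) -fmorphV ltcR.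
Qed.

End Limits.

(** * Products of centered words *)

(** Distributivity for factors with index sets of different types. *)
Lemma prod_sum_fprod (F : comNzRingType) (I : finType) (T_ : I -> finType)
    (G : forall i, T_ i -> F) :
  \prod_i \sum_(q : T_ i) G i q = \sum_(t : fprod T_) \prod_i G i (t i).
Proof.
pose G' i := [ffun q : T_ i => G i q].
transitivity (\sum_(t : fprod T_) \prod_(i in I) G' i (t i)); last first.
  by apply: eq_bigr => t _; apply: eq_bigr => i _; rewrite ffunE.
rewrite big_fprod.
rewrite -[RHS](bigA_distr_big_dep (fun i j => j \in tagged_with T_ i)
                 (fun i => untag 0 (G' i))).
apply: eq_bigr => i _; rewrite -(big_tag G').
by apply: eq_bigr => q _; rewrite ffunE.
Qed.

Section Words.
Variables (d : measure_display) (R : realType).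
Variables (T : nat -> measurableType d) (P : forall N, probability (T N) R).
Variables (C : nat) (L : 'I_C -> Type).
Variable X : forall (c : 'I_C) (N : nat), L c -> T N -> 'M[R[i]]_N.
Variable PM : forall (c : 'I_C) (I : {fset int}), {set {perm (pm I)}}.
Variable f : forall (c : 'I_C), nat ->
         forall I : {fset int}, (int -> L c) -> {perm (pm I)} -> R[i].
Arguments X : clear implicits.
Arguments f : clear implicits.
Hypothesis GX : forall c : 'I_C, condG P (X c) (PM c) (f c).
Hypothesis IX : forall N : nat, (0 < N)%N ->
     mutually_indep_rmx (P N) (fun c : 'I_C => X c N).

Definition letter := {c : 'I_C & L c}.
Definition letter_mx N (l : letter) (t : T N) : 'M[R[i]]_N := X (tag l) N (tagged l) t.

Variables (p : nat) (w : nat -> 'I_C) (wd : nat -> seq letter) (l0 : letter).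
Local Notation mz := (fun i => size (wd i)).
Hypothesis p0 : (0 < p)%N.
Hypothesis wd0 : forall i, (i < p)%N -> (0 < size (wd i))%N.
Hypothesis wd_col : forall i j, (i < p)%N -> (j < size (wd i))%N ->
  tag (nth l0 (wd i) j) = w i.
Hypothesis w_alt : forall b, (b.+1 < p)%N -> w b != w b.+1.

Local Notation n := (block_start mz p).
Local Notation E N := (cexp (P N)).

Definition letter_at k : letter :=
  let i := block_of p mz k in nth l0 (wd i) (k - block_start mz i).

Lemma letter_atE i j : (i < p)%N -> (j < size (wd i))%N ->
  letter_at (block_start mz i + j) = nth l0 (wd i) j.
Proof.
move=> ip jm; rewrite /letter_at (@block_ofE p mz p0 i) ?addKn //.
by rewrite leq_addr block_startS ltn_add2l.
Qed.

(** The labels of the letters of colour c, extended by lc to the positions of other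
    colours. *)
Definition label c (lc : L c) (z : int) : L c :=
  if z is Posz k then tagged_as (Tagged L lc) (letter_at k.-1) else lc.

Lemma letter_mx_label N c (lc : L c) k t : tag (letter_at k) = c ->
  letter_mx (letter_at k) t = X c N (label lc (Posz k.+1)) t.
Proof.
rewrite /label /=; case: (letter_at k) => c' l /= E.
by case: _ / E in lc *; rewrite tagged_asE.
Qed.

(** The weight of the block i in the expansion of its word along a path: phi is the
    pair of vertex functions, as in [int_path]. *)
Definition block_rv N (phi : int -> 'I_N) i (t : T N) : R[i] :=
  \prod_(k <- iota (block_start mz i) (size (wd i)))
     letter_mx (letter_at k) t (phi (Posz k.+1)) (phi (Negz k)).

Lemma tag_letter_at i k : (i < p)%N -> k \in iota (block_start mz i) (size (wd i)) ->
  tag (letter_at k) = w i.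
Proof.
move=> ip; rewrite mem_iota => /andP[ik ki]; rewrite -(subnKC ik).
have lt : (k - block_start mz i < size (wd i))%N by rewrite ltn_subLR.
by rewrite letter_atE // wd_col.
Qed.

Lemma block_rvE N (phi : int -> 'I_N) i c (lc : L c) : (i < p)%N -> w i = c ->
  block_rv phi i = entry_product (X c) (label lc) phi (block_set mz i).
Proof.
move=> ip wi; apply/funext => t; rewrite /block_rv /entry_product /block_set
    big_pos_set ?iota_uniq //.
rewrite big_seq [RHS]big_seq; apply: eq_bigr => k ki.
by rewrite (letter_mx_label lc) // -wi; exact: tag_letter_at ki.
Qed.

Lemma label_inhabited i : (i < p)%N -> L (w i).
Proof.
move=> ip; rewrite -(wd_col ip (wd0 ip)); exact: (tagged (nth l0 (wd i) 0)).
Qed.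

Lemma block_rv_poly N (phi : int -> 'I_N) i : (i < p)%N ->
  rmx_poly (X (w i) N) (block_rv phi i).
Proof.
move=> ip; have lc := label_inhabited ip.
by rewrite (block_rvE phi lc) //; exact: rmx_poly_entry_product.
Qed.

Definition centered_rv N (phi : int -> 'I_N) i (t : T N) : R[i] :=
  block_rv phi i t - E N (block_rv phi i).

Lemma centered_rv_poly N (phi : int -> 'I_N) i : (i < p)%N ->
  rmx_poly (X (w i) N) (centered_rv phi i).
Proof.
by move=> ip; apply: rmx_polyD; [exact: block_rv_poly|exact: rmx_poly_cst].
Qed.

Definition color_rv N (phi : int -> 'I_N) c (t : T N) : R[i] :=
  \prod_(i < p | w i == c) centered_rv phi i t.

Lemma color_rv_poly N (phi : int -> 'I_N) c : rmx_poly (X c N) (color_rv phi c).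
Proof.
by apply: rmx_poly_prod => i /eqP <-; exact: centered_rv_poly.
Qed.

Lemma prod_color_rv N (phi : int -> 'I_N) t :
  \prod_(i < p) centered_rv phi i t = \prod_c color_rv phi c t.
Proof. by rewrite (partition_big (fun i : 'I_p => w i) xpredT). Qed.

(** The only use of independence: grouping the blocks by colour. *)
Lemma cexp_prod_centered_rv N (phi : int -> 'I_N) : (0 < N)%N ->
  cintegrable (P N) (fun t => \prod_(i < p) centered_rv phi i t) /\
  E N (fun t => \prod_(i < p) centered_rv phi i t) = \prod_c E N (color_rv phi c).
Proof.
move=> N0; under eq_fun do rewrite prod_color_rv.
apply: (cexp_prod (G := fun c => rmx_gen (X c N))).
- by move=> c; apply: rmx_gen_measurable; exact: condG_moments (GX c) N N0.
- by move=> A GA; exact: (IX N0).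
- by move=> c; apply: rmx_poly_measurable; exact: color_rv_poly.
- by move=> c; apply: (rmx_poly_cint (condG_moments (GX c) N0)); exact: color_rv_poly.
Qed.

Local Notation colors := (color_set p mz w).

Lemma block_in_color i c : (i < p)%N -> w i = c ->
  (block_set mz i `<=` colors c)%fset.
Proof.
move=> ip wi; apply/fsubsetP => z /pos_setP[k ki ->].
rewrite in_pos_set mem_filter mem_iota /= add0n.
move: ki; rewrite (mem_block (p := p)) // => /andP[kn /eqP bi].
by rewrite bi wi eqxx.
Qed.

(** Stated with abstract weights g so that it also covers colours that do not occur,
    for which there may be no label at all. *)
Lemma color_expansion c :
  exists (Q : {set {perm (pm (colors c))}})
         (g : nat -> {perm (pm (colors c))} -> R[i]),
  [/\ forall q, q \in Q -> q \in premap (colors c) /\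
        forall i, (i < p)%N -> w i = c -> ~~ isolated (block_set mz i) q,
      forall q, q \in Q -> exists l : R[i]^o, ((fun N => g N q : R[i]^o) @ \oo
          --> l)%classic &
      forall N (phi : int -> 'I_N), (0 < N)%N ->
        E N (color_rv phi c) = \sum_(q in Q)
          N%:R ^+ (ncyc q)./2 / N%:R ^+ #|` colors c| * g N q * (compatible phi q)%:R].
Proof.
(* For a colour without letters the product is 1, and so is the only term. *)
have [[i0 i0p wi0]|unused] := pselect (exists2 i, (i < p)%N & w i = c); last first.
  have used0 (i : 'I_p) : (w i == c) = false.
    by apply/negbTE/eqP => wi; apply: unused; exists i.
  have c0 z : z \notin pm (colors c).
    rewrite in_pm_pos_set mem_filter mem_iota /= add0n.
    apply/negP => /and3P[_ /eqP wz zn]; apply: unused.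
    by have [bp _] := block_of_bounds p0 zn; exists (block_of p mz (absz z).-1).
  have card0 : #|` colors c| = 0%N.
    apply/eqP; rewrite cardfs_eq0; apply/eqP/fsetP => z; rewrite inE.
    apply/negP => zc; have /negP := c0 z; apply; rewrite inE; by apply/orP; left.
  exists [set 1%g], (fun _ _ => 1); split.
  - move=> q _; split; last by move=> i ip wi; case: unused; exists i.
    by rewrite inE; apply/forallP => x; have := c0 (val x); rewrite (valP x).
  - by move=> q _; exists 1; exact: cvg_cst.
  - move=> N phi N0; rewrite big_set1 card0 ncyc1 card_pm; last exact: posset_pos_set.
    rewrite card0 expr0 divr1 !mul1r.
    have -> : compatible phi (1 : {perm (pm (colors c))})%g.
      by apply/forallP => x; have := c0 (val x); rewrite (valP x).
    rewrite -[RHS](cexp_cst (P N)); apply: eq_cexp => t.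
    by rewrite /color_rv big_pred0.
have lc : L c by rewrite -wi0; exact: label_inhabited.
pose Js := [seq block_set mz i | i <- iota 0 p & w i == c].
have posI : posset (colors c) := @posset_pos_set _.
exists [set q in PM c (colors c) | all (fun J => ~~ isolated J q) Js],
  (fun N q => f c N _ (label lc) q); split.
- move=> q; rewrite inE => /andP[qP /allP qJ]; split; first exact: PM_premap (GX
    c) _ _ posI qP.
  move=> i ip wi; apply: qJ; apply: map_f.
  by rewrite mem_filter wi eqxx mem_iota add0n.
- move=> q; rewrite inE => /andP[qP _].
  by have [_ [l lP]] := condG_ii (GX c) (label lc) posI qP; exists l.
move=> N phi N0.
have JsI : all (fun J => J `<=` colors c)%fset Js.
  apply/allP => _ /mapP[i + ->]; rewrite mem_filter mem_iota /= add0n.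
  by move=> /andP[/eqP wi ip]; exact: block_in_color.
have Jsd : pairwise (fun J K => [disjoint J & K]%fset) Js.
  have us : uniq [seq i <- iota 0 p | w i == c] by rewrite filter_uniq ?iota_uniq.
  rewrite pairwise_map; move: us; rewrite uniq_pairwise.
  apply: (@sub_in_pairwise _ (fun i => i < p)%N); last first.
    by apply/allP => i; rewrite mem_filter mem_iota add0n => /andP[_].
  move=> i j ip jp /= ne; apply/fdisjointP => z /pos_setP[k ki ->].
  rewrite in_pos_set; move: ki; rewrite !(mem_block (p := p)) //.
  by move=> /andP[-> /eqP ->].
have := centered_expansion (GX c) (label lc) phi N0 posI JsI Jsd.
have -> : outside Js (colors c) = fset0.
  apply/fsetP => z; rewrite in_outside inE; apply/negbTE; rewrite negb_and negbK.
  case: (boolP (z \in colors c)) => //= /pos_setP[k + ->].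
  rewrite mem_filter mem_iota /= add0n => /andP[wk kn].
  have [bp _] := block_of_bounds p0 kn.
  apply/hasP; exists (block_set mz (block_of p mz k)).
    by apply: map_f; rewrite mem_filter wk mem_iota add0n.
  by rewrite in_pos_set (mem_block (p := p)) // kn eqxx.
rewrite [X in _ = X -> _](eq_bigl (mem [set q in PM c (colors c) |
    all (fun J => ~~ isolated J q) Js])); last by move=> q; rewrite !inE.
move=> E1; rewrite -[RHS]E1.
apply: eq_cexp => t; rewrite /entry_product big_seq_fset0 mul1r big_map big_filter.
rewrite /color_rv -(big_mkord (fun i => w i == c) (fun i => centered_rv phi i t)).
rewrite /index_iota subn0 big_seq_cond [RHS]big_seq_cond; apply: eq_bigr => i.
rewrite mem_iota /= add0n => /andP[ip /eqP wi].
by rewrite /centered_rv (block_rvE phi lc).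
Qed.

Definition word_mx N i (t : T N) : 'M[R[i]]_N := \prod_(l <- wd i) letter_mx l t.

Definition word_wt N i (t : T N) (v : nat -> 'I_N) : R[i] :=
  \prod_(j < size (wd i)) letter_mx (nth l0 (wd i) j) t (v j) (v j.+1).

Lemma word_pathmx N i (t : T N) : word_mx i t = pathmx (size (wd i)) (word_wt i t).
Proof.
rewrite /word_mx (big_nth l0) big_mkord.
exact: (prod_pathmx (fun j => letter_mx (nth l0 (wd i) j) t)).
Qed.

Lemma local_word_wt N i (t : T N) : local_to (size (wd i)) (word_wt i t).
Proof. exact: (@local_letters _ _ (fun j => letter_mx (nth l0 (wd i) j) t)). Qed.

Lemma word_wt_block N i (t : T N) (v : nat -> 'I_N) : (i < p)%N ->
  word_wt i t (fun k => v (block_start mz i + k)%N) = block_rv (int_path v) i t.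
Proof.
move=> ip; rewrite /block_rv -[X in iota X _]addn0 iotaDl big_map.
rewrite -[in RHS](subn0 (size (wd i))) -/(index_iota 0 _) big_mkord.
by apply: eq_bigr => j _; rewrite letter_atE //= addnS.
Qed.

(** A path for one word is read as a path through all the words, at the steps of its
    block. *)
Lemma word_wt_shift N i (v : nat -> 'I_N) : (i < p)%N ->
  (fun t => word_wt i t v) = block_rv (int_path (fun k => v (k - block_start mz
      i)%N)) i.
Proof.
move=> ip; apply/funext => t; rewrite -word_wt_block //.
by apply: local_word_wt => k _ /=; rewrite addKn.
Qed.

Definition word_mean N i (v : nat -> 'I_N) : R[i] := E N (fun t => word_wt i t v).

Lemma local_word_mean N i : local_to (size (wd i)) (@word_mean N i).
Proof.
by move=> v v' vv; apply: eq_cexp => t; exact: local_word_wt.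
Qed.

Lemma int_path_comp (V : Type) (r : V -> V) (v : nat -> V) :
  int_path (r \o v) = r \o int_path v.
Proof. by apply/funext => -[]. Qed.

Lemma prod_telescope (V : Type) (s : V -> R[i]) (v : nat -> V) m :
  (forall a, s a * s a = 1) ->
  \prod_(j < m) (s (v j) * s (v j.+1)) = s (v 0%N) * s (v m).
Proof.
move=> s2; elim: m => [|m IHm]; first by rewrite big_ord0 s2.
by rewrite big_ord_recr /= IHm mulrACA -mulrA (mulrA (s (v m))) s2 mul1r.
Qed.

(** The signs telescope along the path of the word. *)
Lemma word_mean_scalar m i : (i < p)%N ->
  pathmx (size (wd i)) (@word_mean m.+1 i) =
  (pathmx (size (wd i)) (@word_mean m.+1 i) ord0 ord0)%:M.
Proof.
move=> ip; have lc := label_inhabited ip.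
have posJ : posset (block_set mz i) := @posset_pos_set _.
have meanE v : @word_mean m.+1 i v =
    E m.+1 (entry_product (X (w i)) (label lc) (int_path (fun k => v (k -
        block_start mz i)%N)) (block_set mz i)).
  by rewrite /word_mean word_wt_shift // (block_rvE _ lc).
apply: pathmx_scalar; first exact: local_word_mean.
  move=> r v r_inj; rewrite !meanE.
  rewrite -[RHS](cexp_entry_product_relabel (GX (w i)) (label lc) _ _ posJ r_inj) //.
  by rewrite -int_path_comp.
move=> s v s2; rewrite meanE -[RHS](cexp_entry_product_sign (GX (w i)) (label lc)
    _ _ posJ s2) //.
congr (_ * _); rewrite -(prod_telescope v (size (wd i)) s2) big_pos_set ?iota_uniq //.
rewrite -[X in iota X _]addn0 iotaDl big_map.
rewrite -[in RHS](subn0 (size (wd i))) -/(index_iota 0 _) big_mkord.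
by apply: eq_bigr => j _ /=; rewrite addKn -addnS addKn.
Qed.

Lemma cint_word_wt N i (v : nat -> 'I_N) : (0 < N)%N -> (i < p)%N ->
  cintegrable (P N) (fun t => word_wt i t v).
Proof.
move=> N0 ip; rewrite word_wt_shift //.
by apply: (rmx_poly_cint (condG_moments (GX (w i)) N0)); exact: block_rv_poly.
Qed.

Lemma cexp_pathmx N i a b : (0 < N)%N -> (i < p)%N ->
  cintegrable (P N) (fun t => word_mx i t a b) /\
  E N (fun t => word_mx i t a b) = pathmx (size (wd i)) (@word_mean N i) a b.
Proof.
move=> N0 ip; have iW (s : (size (wd i)).-tuple 'I_N) : cintegrable (P N)
    (fun t => (nth a (a :: s) (size (wd i)) == b)%:R * word_wt i t (nth a (a :: s))).
  by apply: cintZ; exact: cint_word_wt.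
have WE : (fun t => word_mx i t a b) = (fun t =>
    \sum_(s : (size (wd i)).-tuple 'I_N)
     (nth a (a :: s) (size (wd i)) == b)%:R * word_wt i t (nth a (a :: s))).
  apply/funext => t; rewrite word_pathmx mxE.
  by apply: eq_bigr => s _; rewrite mulrC.
split; first by rewrite WE; apply: cint_sum => s _; exact: iW.
rewrite WE cexp_sum // mxE; apply: eq_bigr => s _.
by rewrite cexpZ; [rewrite mulrC|exact: cint_word_wt].
Qed.

Lemma cexp_ntr_word m i : (i < p)%N ->
  (E m.+1 (fun t => ntr (word_mx i t)))%:M = pathmx (size (wd i)) (@word_mean m.+1 i).
Proof.
move=> ip; have N0 : (0 < m.+1)%N by [].
have -> : E m.+1 (fun t => ntr (word_mx i t)) =
    ntr (pathmx (size (wd i)) (@word_mean m.+1 i)).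
  rewrite /ntr /mxtrace mulrC mulr_sumr.
  under [RHS]eq_bigr => a _ do rewrite -(cexp_pathmx a a N0 ip).2 -(cexpZ _
      (cexp_pathmx a a N0 ip).1).
  rewrite -cexp_sum; last by move=> a _; apply: cintZ; exact: (cexp_pathmx a a N0 ip).1.
  by apply: eq_cexp => t; rewrite mulrC mulr_sumr.
rewrite [in LHS]word_mean_scalar // /ntr mxtrace_scalar -[X in X / _]mulr_natr mulfK //.
by rewrite -word_mean_scalar.
Qed.

(** Centering the word by its mean trace centers the weight of each path. *)
Lemma centered_word_pathmx m i (t : T m.+1) : (i < p)%N ->
  centered P (fun u => word_mx i u) t =
  pathmx (size (wd i)) (fun v => word_wt i t v - word_mean i v).
Proof.
move=> ip; rewrite /centered cexp_ntr_word // word_pathmx.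
apply/matrixP => a b; rewrite !mxE -sumrB; apply: eq_bigr => s _.
by rewrite mulrBl.
Qed.

Lemma word_mean_block N i (v : nat -> 'I_N) : (i < p)%N ->
  word_mean i (fun k => v (block_start mz i + k)%N) = E N (block_rv (int_path v) i).
Proof. by move=> ip; apply: eq_cexp => t; rewrite word_wt_block. Qed.

Lemma ntr_prod_centered m (t : T m.+1) :
  ntr (\prod_(i < p) centered P (fun u => word_mx i u) t) =
  m.+1%:R^-1 * \sum_(s : n.-tuple 'I_m.+1)
    \prod_(i < p) centered_rv (int_path (closed_path s)) i t.
Proof.
under eq_bigr => i _ do rewrite centered_word_pathmx //.
have loc i : local_to (size (wd i)) (fun v => word_wt i t v - word_mean i v).
  move=> v v' vv; congr (_ - _); first exact: local_word_wt.
  exact: local_word_mean.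
rewrite (prod_blocks_pathmx p loc) /ntr mulrC; congr (_ * _).
have -> : (\sum_(i < p) size (wd i) = n)%N by [].
rewrite mxtrace_pathmx //.
- apply: eq_bigr => s _; apply: eq_bigr => i _.
  by rewrite /centered_rv -word_wt_block // -word_mean_block.
- exact: letter_count_gt0.
- move=> v v' vv; apply: eq_bigr => i _; apply: (local_shift (loc i)) => k ki.
  apply: vv; apply: (leq_trans ki); rewrite -(@block_startS mz i).
  exact: block_start_mono (ltn_ord i).
Qed.

Lemma cint_word_product m : cintegrable (P m.+1)
  (fun t => ntr (\prod_(i < p) centered P (fun u => word_mx i u) t)).
Proof.
rewrite (funext (ntr_prod_centered (m := m))); apply: cintZ; apply: cint_sum => s _.
exact: (cexp_prod_centered_rv _ _).1.
Qed.

Lemma word_moment m :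
  E m.+1 (fun t => ntr (\prod_(i < p) centered P (fun u => word_mx i u) t)) =
  m.+1%:R^-1 * \sum_(s : n.-tuple 'I_m.+1)
    \prod_c E m.+1 (color_rv (int_path (closed_path s)) c).
Proof.
have N0 : (0 < m.+1)%N by [].
have iC (s : n.-tuple 'I_m.+1) := (cexp_prod_centered_rv (int_path (closed_path
    s)) N0).1.
rewrite (eq_cexp _ (ntr_prod_centered (m := m))) cexpZ; last first.
  by apply: cint_sum => s _; exact: iC.
congr (_ * _); rewrite cexp_sum //.
by apply: eq_bigr => s _; rewrite (cexp_prod_centered_rv _ N0).2.
Qed.

Lemma card_color_sets : (\sum_c #|` colors c| = n)%N.
Proof.
rewrite -[RHS](size_iota 0) -sum1_size (partition_big (fun k => w (block_of p mz
    k)) xpredT) //=.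
apply: eq_bigr => c _.
by rewrite card_pos_set ?filter_uniq ?iota_uniq // size_filter -sum1_count.
Qed.

(** The coefficient of prod_c g c (q c) in the expectation of the normalized trace. *)
Definition count_weight m (q : forall c, {perm (pm (colors c))}) : R[i] :=
  m.+1%:R^-1 * (\prod_c (m.+1%:R ^+ (ncyc (q c))./2 / m.+1%:R ^+ #|` colors c|)) *
  #|[set s : n.-tuple 'I_m.+1 |
      [forall c, compatible (int_path (closed_path s)) (q c)]]|%:R.

Lemma count_weight_bound m (q : forall c, {perm (pm (colors c))}) :
  (forall c, q c \in premap (colors c)) ->
  (forall i, (i < p)%N -> ~~ isolated (block_set mz i) (q (w i))) ->
  0 <= count_weight m q <= m.+1%:R^-1.
Proof.
move=> qP qiso; rewrite /count_weight prodf_div.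
rewrite -!expr_sum card_color_sets; set h := (\sum_c _)%N; set k := #|_|.
have hk : (m.+1 ^ h * k <= m.+1 ^ n)%N := count_bound p0 w_alt m qP qiso.
have m0 : (0 : R[i]) < m.+1%:R by rewrite ltr0n.
apply/andP; split.
  by rewrite !mulr_ge0 ?invr_ge0 ?exprn_ge0 ?ler0n.
rewrite -mulrA ger_pMr ?invr_gt0 // mulrAC ler_pdivrMr ?exprn_gt0 // mul1r.
by rewrite -!natrX -natrM ler_nat.
Qed.

(** A sum of finitely many terms, whose number does not depend on N: each is a
    convergent sequence times a [count_weight], which is at most 1/N. *)
Lemma word_limit :
  ((fun N => E N (fun t => ntr (\prod_(i < p) centered P (fun u => word_mx i u) t))
     : R[i]^o) @ \oo --> (0 : R[i]^o))%classic.
Proof.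
have H c : {Qg : {set {perm (pm (colors c))}} * (nat -> {perm (pm (colors c))} ->
    R[i]) |
  [/\ forall q, q \in Qg.1 -> q \in premap (colors c) /\
        forall i, (i < p)%N -> w i = c -> ~~ isolated (block_set mz i) q,
      forall q, q \in Qg.1 -> exists l : R[i]^o,
        ((fun N => Qg.2 N q : R[i]^o) @ \oo --> l)%classic &
      forall N (phi : int -> 'I_N), (0 < N)%N ->
        E N (color_rv phi c) = \sum_(q in Qg.1)
          N%:R ^+ (ncyc q)./2 / N%:R ^+ #|` colors c| * Qg.2 N q * (compatible
              phi q)%:R]}.
  by apply: cid; have [Q [g Hg]] := color_expansion c; exists (Q, g).
pose Q c := (sval (H c)).1; pose g c := (sval (H c)).2.
pose Pi := fprod (fun c => {perm (pm (colors c))} : finType).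
pose good (q : Pi) := [forall c, q c \in Q c].
rewrite -cvg_shiftS /=.
have -> : (fun m => E m.+1 (fun t =>
      ntr (\prod_(i < p) centered P (fun u => word_mx i u) t))) =
    (fun m => \sum_(q : Pi | good q) (\prod_c g c m.+1 (q c)) * count_weight m
        (fun c => q c)).
  apply/funext => m; rewrite word_moment.
  pose A (c : 'I_C) (q : {perm (pm (colors c))}) : R[i] :=
    m.+1%:R ^+ (ncyc q)./2 / m.+1%:R ^+ #|` colors c|.
  pose W (s : n.-tuple 'I_m.+1) c (q : {perm (pm (colors c))}) : R[i] :=
    if q \in Q c then A c q * g c m.+1 q *
      (compatible (int_path (closed_path s)) q)%:R else 0.
  transitivity (m.+1%:R^-1 * \sum_(s : n.-tuple 'I_m.+1) \sum_(q : Pi) \prod_c W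
      s c (q c)).
    congr (_ * _); apply: eq_bigr => s _; rewrite -prod_sum_fprod.
    apply: eq_bigr => c _; have [_ _ ->] // := svalP (H c).
    by rewrite big_mkcond.
  rewrite exchange_big mulr_sumr [RHS]big_mkcond; apply: eq_bigr => q _.
  have [/forallP qQ|/forallPn[c qc]] := boolP (good q); last first.
    rewrite big1 ?mulr0 // => s _; rewrite (bigD1 c) //= {1}/W.
    by rewrite (negbTE qc) mul0r.
  have WE s : \prod_c W s c (q c) = (\prod_c A c (q c)) * (\prod_c g c m.+1 (q c)) *
      [forall c, compatible (int_path (closed_path s)) (q c)]%:R.
    have -> : [forall c, compatible (int_path (closed_path s)) (q c)]%:R =
        \prod_c (compatible (int_path (closed_path s)) (q c))%:R :> R[i].
      case: forallP => [cs|/forallP/forallPn[c cs]].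
        by rewrite big1 // => c _; rewrite cs.
      by rewrite (bigD1 c) //= (negbTE cs) mul0r.
    rewrite -!big_split /=; apply: eq_bigr => c _.
    by rewrite /W qQ.
  under eq_bigr do rewrite WE.
  rewrite -mulr_sumr /count_weight -sum1_card natr_sum [X in _ = _ * (_ *
      X)]big_mkcond /=.
  rewrite (eq_bigr (fun s : n.-tuple 'I_m.+1 => if s \in [set s : n.-tuple 'I_m.+1 |
    [forall c, compatible (int_path (closed_path s)) (q c)]] then 1%:R else 0));
        last first.
    by move=> s _; rewrite inE; case: ifP.
  set S := \sum_s _; set B := \prod_c A _ _; set D := \prod_c g _ _ _.
  by rewrite -/B; ring.
apply: (@cvg_sum_null R[i] Pi) => q /forallP qQ.
  apply: cvg_prod_seq => c; have [_ + _] := svalP (H c).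
  move=> /(_ _ (qQ c))[l lP]; exists l.
  by rewrite -cvg_shiftS in lP; exact: lP.
apply: cvg_complex_inv_null => m; apply: count_weight_bound.
  by move=> c; have [+ _ _] := svalP (H c); move=> /(_ _ (qQ c))[].
by move=> i ip; have [+ _ _] := svalP (H (w i)); move=> /(_ _ (qQ (w i)))[_]; apply.
Qed.

End Words.

(** * From words to noncommutative polynomials *)

Section Freeness.
Variables (d : measure_display) (R : realType).
Variables (T : nat -> measurableType d) (P : forall N, probability (T N) R).
Variables (C : nat) (L : 'I_C -> Type).
Variable X : forall (c : 'I_C) (N : nat), L c -> T N -> 'M[R[i]]_N.
Variable PM : forall (c : 'I_C) (I : {fset int}), {set {perm (pm I)}}.
Variable f : forall (c : 'I_C), nat ->
         forall I : {fset int}, (int -> L c) -> {perm (pm I)} -> R[i].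
Arguments X : clear implicits.
Arguments f : clear implicits.
Hypothesis GX : forall c : 'I_C, condG P (X c) (PM c) (f c).
Hypothesis IX : forall N : nat, (0 < N)%N ->
     mutually_indep_rmx (P N) (fun c : 'I_C => X c N).

Definition monomial c N (s : seq (L c)) (t : T N) : 'M[R[i]]_N :=
  \prod_(l <- s) X c N l t.

Lemma monomial_poly c N (s : seq (L c)) a b :
  rmx_poly (X c N) (fun t => monomial s t a b).
Proof.
rewrite /monomial; elim: s a b => [|l s IHs] a b.
  by under eq_fun do rewrite big_nil; exact: rmx_poly_cst.
under eq_fun do rewrite big_cons -[_ * _]/(mulmx _ _) mxE.
by apply: rmx_poly_sum => e; apply: rmx_polyM => //; exact: rmx_poly_entry.
Qed.

Lemma cint_ntr_monomial c N (s : seq (L c)) : (0 < N)%N ->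
  cintegrable (P N) (fun t => ntr (monomial s t)).
Proof.
move=> N0; apply: (rmx_poly_cint (condG_moments (GX c) N0)).
rewrite /ntr /mxtrace; apply: rmx_polyM; last exact: rmx_poly_cst.
by apply: rmx_poly_sum => a; exact: monomial_poly.
Qed.

Lemma ntr_linear (F : fieldType) N (I : Type) (r : seq I) (Q : pred I)
    (k : I -> F) (M : I -> 'M[F]_N) :
  ntr (\sum_(j <- r | Q j) k j *: M j) = \sum_(j <- r | Q j) k j * ntr (M j).
Proof.
rewrite /ntr raddf_sum /= mulr_suml; apply: eq_bigr => j _.
by rewrite mxtraceZ mulrA.
Qed.

(** Centering is linear, so that polynomials reduce to monomials. *)
Lemma centered_nceval c N (a : ncpoly R[i] (L c)) t : (0 < N)%N ->
  centered P (fun u => nceval a (fun l => X c N l u)) t =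
  \sum_(m <- a) m.1 *: centered P (fun u => monomial m.2 u) t.
Proof.
move=> N0; rewrite /centered.
have -> : cexp (P N) (fun u => ntr (nceval a (fun l => X c N l u))) =
    \sum_(m <- a) m.1 * cexp (P N) (fun u => ntr (monomial m.2 u)).
  under eq_cexp do rewrite /nceval ntr_linear.
  rewrite cexp_sum; last by move=> m _; apply: cintZ; exact: cint_ntr_monomial.
  by apply: eq_bigr => m _; rewrite cexpZ //; exact: cint_ntr_monomial.
rewrite raddf_sum /= -sumrB; apply: eq_bigr => m _.
by rewrite scalerBr scale_scalar_mx.
Qed.

Section Monomials.
Variables (p : nat) (w : 'I_p -> 'I_C) (s : forall i, seq (L (w i))).
Hypothesis p0 : (0 < p)%N.
Hypothesis w_alt : forall i j : 'I_p, j = i.+1 :> nat -> w i != w j.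

Definition monomial_product N (t : T N) : 'M[R[i]]_N :=
  \prod_(i < p) centered P (fun u => monomial (s i) u) t.

Lemma centered_empty m (i : 'I_p) (t : T m.+1) : s i = [::] ->
  centered P (fun u => monomial (s i) u) t = 0.
Proof.
move=> si; rewrite /centered /monomial si big_nil.
under eq_cexp do rewrite big_nil.
rewrite cexp_cst /ntr -[1 in LHS]/(1%:M) mxtrace1 divff ?subrr //.
Qed.

(** The words of [word_limit] are nonempty; an empty word is the identity matrix, whose
    centered version is 0. *)
Lemma monomial_product_limit :
  (forall m, cintegrable (P m.+1) (fun t => ntr (monomial_product t))) /\
  ((fun m => cexp (P m.+1) (fun t => ntr (monomial_product t)) : R[i]^o)
     @ \oo --> (0 : R[i]^o))%classic.
Proof.
have [[i si]|no_empty] := pselect (exists i, s i = [::]).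
  have E m (t : T m.+1) : ntr (monomial_product t) = 0.
    suff -> : monomial_product t = 0 by rewrite /ntr mxtrace0 mul0r.
    rewrite /monomial_product.
    elim: (index_enum _) (mem_index_enum i) => // j r IHr; rewrite big_cons inE.
    case: eqVneq => [<- _|_ /= /IHr ->]; last by rewrite mulr0.
    by rewrite centered_empty // mul0r.
  split=> [m|]; first by under eq_fun do rewrite E; exact: cint_cst.
  by under eq_fun do rewrite (eq_cexp _ (E _)) cexp_cst; exact: cvg_cst.
pose i0 : 'I_p := Ordinal p0.
have [l0 _] : exists l0 : letter L, True.
  case E : (s i0) => [|l r]; first by case: no_empty; exists i0.
  by exists (Tagged L l).
pose wn (k : nat) : 'I_C := if (insub k : option 'I_p) is Some i then w i else w i0.
pose wd (k : nat) : seq (letter L) :=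
  if (insub k : option 'I_p) is Some i then map (Tagged L) (s i) else [::].
have wnE (i : 'I_p) : wn i = w i by rewrite /wn valK.
have wdE (i : 'I_p) : wd i = map (Tagged L) (s i) by rewrite /wd valK.
have wd0 k : (k < p)%N -> (0 < size (wd k))%N.
  move=> kp; rewrite -[k]/(val (Ordinal kp)) wdE size_map.
  by case E : (s (Ordinal kp)) => [|l r] //; case: no_empty; exists (Ordinal kp).
have wd_col k j : (k < p)%N -> (j < size (wd k))%N -> tag (nth l0 (wd k) j) = wn k.
  move=> kp; rewrite -[k]/(val (Ordinal kp)) wdE wnE size_map => js.
  case E : (s (Ordinal kp)) js => [//|l r] js.
  by rewrite (nth_map l).
have wn_alt b : (b.+1 < p)%N -> wn b != wn b.+1.
  move=> bp; rewrite -[b.+1]/(val (Ordinal bp)) -[b]/(val (Ordinal (ltnW bp))) !wnE.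
  exact: w_alt.
have mE N (i : 'I_p) : (fun u : T N => monomial (s i) u) = word_mx X wd i.
  by apply/funext => u; rewrite /word_mx wdE big_map.
have PE N (t : T N) : monomial_product t =
    \prod_(i < p) centered P (fun u => word_mx X wd i u) t.
  by apply: eq_bigr => i _; rewrite mE.
have E m : (fun t : T m.+1 => ntr (monomial_product t)) =
   (fun t => ntr (\prod_(i < p) centered P (fun u => word_mx X wd i u) t)).
  by apply/funext => t; rewrite PE.
split=> [m|]; first by rewrite E; exact: (cint_word_product GX IX p0 wd0 wd_col).
under eq_fun do rewrite E.
have := word_limit GX IX p0 wd0 wd_col wn_alt.
by rewrite -cvg_shiftS.
Qed.

End Monomials.

Lemma condG_asymptotically_free : asymptotically_free P X.
Proof.
move=> p w a p0 w_alt.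
pose M := (\max_(i < p) size (a i))%N.
pose term i j := nth (0, [::]) (a i) j.
have aM i : (size (a i) <= M)%N by apply: (leq_bigmax i).
pose s (g : {ffun 'I_p -> 'I_M}) i := (term i (g i)).2.
pose k (g : {ffun 'I_p -> 'I_M}) : R[i] := \prod_i (term i (g i)).1.
pose G := family (fun i : 'I_p => [pred j : 'I_M | (j < size (a i))%N]).
have expand m (t : T m.+1) :
    \prod_(i < p) centered P (fun u => nceval (a i) (fun l => X (w i) m.+1 l u)) t =
    \sum_(g in G) k g *: monomial_product (s g) t.
  under eq_bigr => i _.
    rewrite centered_nceval // (big_nth (0, [::])) big_mkord (big_ord_widen _
      (fun j => (term i j).1 *: centered P (fun u => monomial (term i j).2 u) t)
          (aM i)).
    over.
  rewrite bigA_distr_big_dep; apply: eq_bigr => g _.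
  by rewrite scaler_prod.
rewrite -cvg_shiftS /=.
have -> : (fun m => cexp (P m.+1) (fun t => ntr (\prod_(i < p)
      centered P (fun u => nceval (a i) (fun l => X (w i) m.+1 l u)) t))) =
    (fun m => \sum_(g in G) k g * cexp (P m.+1) (fun t => ntr (monomial_product
        (s g) t))).
  apply/funext => m.
  have iM g : cintegrable (P m.+1) (fun t => ntr (monomial_product (s g) t)).
    exact: (monomial_product_limit (s g) p0 w_alt).1.
  transitivity (cexp (P m.+1)
    (fun t => \sum_(g in G) k g * ntr (monomial_product (s g) t))).
    apply: eq_cexp => t.
    rewrite expand.
    exact: ntr_linear.
  rewrite cexp_sum; last by move=> g _; apply: cintZ; exact: iM.
  by apply: eq_bigr => g _; rewrite cexpZ.
apply: (@cvg_sum_null R[i] _ _ _ (fun g _ => k g)) => g _.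
  by exists (k g); exact: cvg_cst.
exact: (monomial_product_limit (s g) p0 w_alt).2.
Qed.

End Freeness.

Theorem lemma6p1 (d : measure_display) (R : realType)
  (T : nat -> measurableType d) (P : forall N, probability (T N) R)
  (C : nat) (L : 'I_C -> Type)
  (X : forall (c : 'I_C) (N : nat), L c -> T N -> 'M[R[i]]_N)
  (PM : forall (c : 'I_C) (I : {fset int}), {set {perm (pm I)}})
  (f : forall (c : 'I_C), nat ->
         forall I : {fset int}, (int -> L c) -> {perm (pm I)} -> R[i]) :
  (forall c : 'I_C, condG P (X c) (PM c) (f c)) ->
  (forall N : nat, (0 < N)%N ->
     mutually_indep_rmx (P N) (fun c : 'I_C => X c N)) ->
  asymptotically_free P X.
Proof. exact: condG_asymptotically_free. Qed.
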